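(* Let $p,q,K,N$ be positive integers with $q\le p$ and $K\le N$, and put $M=N/K$. The functions $$\psi_j(x)=\frac{\Phi_p\big(Kx+(p+1)/2,\exp(-2\pi \mathrm{i}\, j/K)\big)}{Q_{p,M}(j/K)^{1/2}}\qquad(j=1,\ldots,K),\quad x\in\mathbb{R},$$ form the complex-valued Demmler--Reinsch basis in the periodic spline space $\mathcal{S}_{\rm per}(p;\underline{\tau}_K)$, i.e., they form a basis of this space and, for all $i,j=1,\ldots,K$, $$\frac1N\sum_{l=1}^N\psi_i(l/N)\overline{\psi_j(l/N)}=\delta_{i,j},\qquad \int_0^1\psi_i^{(q)}(x)\overline{\psi_j^{(q)}(x)}\,dx=\nu_i\,\delta_{i,j},$$ with eigenvalues $$\nu_j=(2\pi j)^{2q}\,\mathrm{sinc}(\pi j/K)^{2q}\,\frac{Q_{2p-2q}(j/K)}{Q_{p,M}(j/K)} .$$ Moreover, the functions $$\phi_j(x)=\frac{\Phi_p\big(Kx+(p+1)/2,\exp(-2\pi \mathrm{i}\, j/K)\big)}{Q_{2p}(j/K)^{1/2}}\qquad(j=1,\ldots,K)$$ satisfy, for all $i,j=1,\ldots,K$, $$\int_0^1\phi_i(x)\overline{\phi_j(x)}\,dx=\delta_{i,j},\qquad \int_0^1\phi_i^{(q)}(x)\overline{\phi_j^{(q)}(x)}\,dx=\mu_i\,\delta_{i,j},$$ where $\mu_j=(2\pi j)^{2q}\,\mathrm{sinc}(\pi j/K)^{2q}\,Q_{2p-2q}(j/K)/Q_{2p}(j/K)$.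
   Context: $\mathrm{i}=(-1)^{1/2}$; $\mathrm{sinc}(x)=\sin(x)/x$, $\mathrm{sinc}(0)=1$; $\delta_{i,j}$ is the Kronecker delta; $\lfloor t\rfloor$ is the largest integer not greater than $t$ and $\{t\}$ is the fractional part of $t$. Euler--Frobenius polynomials: $\Pi_0=1$ and $\Pi_j$ ($j\ge1$, degree $j-1$) are given by $\frac{z-1}{z-e^{s}}=\sum_{j\ge0}\frac{\Pi_j(z)}{(z-1)^j}\frac{s^j}{j!}$ (e.g. $\Pi_1=1$, $\Pi_2=z+1$, $\Pi_3=z^2+4z+1$). Exponential splines: for $t\in\mathbb{R}$, $z\ne0,1$, $$\Phi_p(t,z)=z^{\lfloor t\rfloor}(1-z^{-1})^p\sum_{j=0}^p\binom pj\frac{\{t\}^{p-j}\,\Pi_j(z)}{p!\,(z-1)^j}$$ (convention $0^0=1$), and $\Phi_p(t,1)=1$. $Q$-functions: for an integer $m\ge0$, $Q_m(z)=\sum_{l=-\infty}^\infty \mathrm{sinc}(\pi(z+l))^{m+2}$ (so $Q_{2p}$ has exponent $2p+2$ and $Q_{2p-2q}$ has exponent $2p-2q+2$). With $M=N/K$, $$Q_{p,M}(z)=\frac1N\sum_{l=1}^N\left|\Phi_p\big(l/M+(p+1)/2,\exp(-2\pi\mathrm{i}z)\big)\right|^2 .$$ Spline spaces: $\underline{\tau}_K=\{0=\tau_0<\tau_1<\cdots<\tau_K=1\}$ with equidistant knots $\tau_i=i/K$ ($i=0,\ldots,K$). $\mathcal{S}(p;\underline{\tau}_K)$ consists of the functions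 $s\in C^{p-1}[0,1]$ that are a degree $p$ polynomial on each $[\tau_i,\tau_{i+1})$ ($i=0,\ldots,K-1$), and $\mathcal{S}_{\rm per}(p;\underline{\tau}_K)=\{s\in\mathcal{S}(p;\underline{\tau}_K):\ s^{(j)}(0)=s^{(j)}(1),\ j=0,\ldots,p-1\}$ (here with complex-valued functions allowed). The points $l/N$ ($l=1,\ldots,N$) are the equally spaced design points.
   Formalization: The discrete orthogonality for i ≠ j is asserted only when K divides N (it fails e.g. for p=1, K=2, N=3); for even p, the shifted functions ψ_j(x+1/(2K)) form the basis of S_per(p;τ_K), since ψ_j itself has its knots at the midpoints (i+1/2)/K. *)

(* Defs.v *)
From HB Require Import structures.
From mathcomp Require Import all_boot all_order all_algebra.
From mathcomp Require Import all_classical all_reals all_analysis.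
From mathcomp Require Import complex.

Set Implicit Arguments.
Unset Strict Implicit.
Unset Printing Implicit Defensive.

Import Order.TTheory GRing.Theory Num.Theory.
Import numFieldNormedType.Exports.

Local Open Scope classical_set_scope.
Local Open Scope complex_scope.
Local Open Scope ring_scope.

Section ComplexValued.
Variable R : realType.

Definition expi (x : R) : R[i] := cos x +i* sin x.

(* Derivatives and integrals of complex-valued functions of a real variable are
   taken on real and imaginary parts. *)
Definition cderive (n : nat) (f : R -> R[i]) (x : R) : R[i] :=
  derive1n n (fun y => complex.Re (f y)) x +i*
  derive1n n (fun y => complex.Im (f y)) x.

Definition cintegral01 (f : R -> R[i]) : R[i] :=
  (\int[lebesgue_measure]_(x in `[0%R, 1%R]) complex.Re (f x)) +i*
  (\int[lebesgue_measure]_(x in `[0%R, 1%R]) complex.Im (f x)).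

Definition sqmod (z : R[i]) : R := Normc.normc z ^+ 2.

End ComplexValued.

Section ExponentialSplines.
Variable R : realType.

Definition sinc (x : R) : R := if x == 0 then 1 else sin x / x.

(* [Pi_j(z) / (z-1)^j] is the coefficient of [s^j / j!] in the Taylor expansion
   at [s = 0] of [(z - 1) / (z - e^s)], that is, its [j]-th derivative at 0.
   Meaningful for [z != 1] only. *)
Definition EulerFrobenius (j : nat) (z : R[i]) : R[i] :=
  (z - 1) ^+ j * cderive j (fun s : R => (z - 1) / (z - (expR s)%:C)) 0.

Definition fracpart (t : R) : R := t - (Num.floor t)%:~R.

Definition Phi (p : nat) (t : R) (z : R[i]) : R[i] :=
  if z == 1 then 1
  else z ^ (Num.floor t) * (1 - z^-1) ^+ p *
       \sum_(0 <= j < p.+1)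
         'C(p, j)%:R * ((fracpart t)%:C ^+ (p - j) * EulerFrobenius j z)
           / (p`!%:R * (z - 1) ^+ j).

(* The bilateral series is split as [l >= 0] plus [l <= -1]. *)
Definition Q (m : nat) (z : R) : R :=
  limn (series (fun l : nat => sinc (pi * (z + l%:R)) ^+ (m + 2))) +
  limn (series (fun l : nat => sinc (pi * (z - l.+1%:R)) ^+ (m + 2))).

(* [Q_{p,M}] with [M = N / K] *)
Definition QM (p K N : nat) (z : R) : R :=
  let M : R := N%:R / K%:R in
  N%:R^-1 * \sum_(1 <= l < N.+1)
    sqmod (Phi p (l%:R / M + p.+1%:R / 2) (expi (- (2 * pi * z)))).

(* [Phi p t z] is polynomial in [t] between consecutive integers.  Hence the
   breakpoints of [x |-> Phi p (K x + (p+1)/2) z] are the points [i / K] when [p]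
   is odd, but the midpoints [(i + 1/2) / K] when [p] is even. *)
Definition psi (p K N j : nat) (x : R) : R[i] :=
  Phi p (K%:R * x + p.+1%:R / 2) (expi (- (2 * pi * (j%:R / K%:R))))
    / (Num.sqrt (QM p K N (j%:R / K%:R)))%:C.

Definition phi (p K j : nat) (x : R) : R[i] :=
  Phi p (K%:R * x + p.+1%:R / 2) (expi (- (2 * pi * (j%:R / K%:R))))
    / (Num.sqrt (Q (2 * p) (j%:R / K%:R)))%:C.

Definition nu (p q K N j : nat) : R :=
  (2 * pi * j%:R) ^+ (2 * q) * sinc (pi * j%:R / K%:R) ^+ (2 * q) *
  (Q (2 * p - 2 * q) (j%:R / K%:R) / QM p K N (j%:R / K%:R)).

Definition mu (p q K j : nat) : R :=
  (2 * pi * j%:R) ^+ (2 * q) * sinc (pi * j%:R / K%:R) ^+ (2 * q) *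
  (Q (2 * p - 2 * q) (j%:R / K%:R) / Q (2 * p) (j%:R / K%:R)).

End ExponentialSplines.

Section SplineSpaces.
Variable R : realType.

(* Calculus on [0,1]: only points of [0,1] enter the difference quotients, so
   the derivatives at 0 and 1 are one-sided. *)
Definition quot01 (f : R -> R) (x y : R) : R := (f y - f x) / (y - x).

Definition derivable01 (f : R -> R) : Prop :=
  forall x : R, x \in `[0, 1] -> cvg (quot01 f x y @[y --> within `[0, 1] x^']).

Definition derive01 (f : R -> R) (x : R) : R :=
  lim (quot01 f x y @[y --> within `[0, 1] x^']).

Definition derive01n (n : nat) (f : R -> R) : R -> R := iter n derive01 f.

Definition C01 (n : nat) (f : R -> R) : Prop :=
  (forall k, (k < n)%N -> derivable01 (derive01n k f)) /\
  {within `[0, 1], continuous (derive01n n f)}.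

Definition cC01 (n : nat) (s : R -> R[i]) : Prop :=
  C01 n (fun x => complex.Re (s x)) /\ C01 n (fun x => complex.Im (s x)).

Definition cderive01n (n : nat) (s : R -> R[i]) (x : R) : R[i] :=
  derive01n n (fun y => complex.Re (s y)) x +i*
  derive01n n (fun y => complex.Im (s y)) x.

Definition knot (K i : nat) : R := i%:R / K%:R.

(* Splines are represented by functions on [R] of which only the values on
   [0,1] matter. *)
Definition spline (p K : nat) (s : R -> R[i]) : Prop :=
  cC01 p.-1 s /\
  forall i, (i < K)%N -> exists P : {poly R[i]},
    (size P <= p.+1)%N /\
    forall x, knot K i <= x < knot K i.+1 -> s x = P.[x%:C].

Definition periodic_spline (p K : nat) (s : R -> R[i]) : Prop :=
  spline p K s /\
  forall j, (j < p)%N -> cderive01n j s 0 = cderive01n j s 1.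

(* [e 1, ..., e K] is a basis of the complex vector space [V] of functions on
   [0,1]. *)
Definition basis01 (V : (R -> R[i]) -> Prop) (K : nat)
    (e : nat -> R -> R[i]) : Prop :=
  [/\ forall j, (0 < j <= K)%N -> V (e j),
      forall c : nat -> R[i],
        (forall x : R, x \in `[0, 1] -> \sum_(1 <= j < K.+1) c j * e j x = 0) ->
        forall j, (0 < j <= K)%N -> c j = 0
    & forall s, V s -> exists c : nat -> R[i],
        forall x : R, x \in `[0, 1] -> s x = \sum_(1 <= j < K.+1) c j * e j x].

End SplineSpaces.

(* Main.v *)
Require Import Defs.
From mathcomp Require Import all_boot all_order all_algebra.
From mathcomp Require Import all_classical all_reals all_analysis.
From mathcomp Require Import complex.
From mathcomp Require Import ring lra zify measurable_realfun.

(* Fix [z = e^{-2 i pi u}] with [u = j / K].  Then [Phi p t z] is [z^n] times a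
   polynomial [F_p] in [t - n] on [[n, n + 1]], with [F_p' = (1 - 1/z) F_{p-1}]
   and [F_p(1) = z F_p(0)].  So Phi is quasi-periodic, its q-th derivative is a
   multiple of [Phi (p - q)], and functions for different [j] are orthogonal
   because a nontrivial sum of [K]-th roots of unity vanishes.

   The diagonal integrals reduce, integrating by parts [m] times, to
   [int_0^1 |F_m|^2 = z^{m+1} F_{2m+1}(0)], which is a derivative in [s] of
   [1 / (z - e^s)].  This function depends only on [s + 2 i pi u], so it is also a
   derivative in [u], and [sum_l (u + l)^-2 = pi^2 / sin^2 (pi u)] differentiated
   term by term identifies it with [Q_{2m}(u)].  The latter identity follows from
   the duplication formula of [1 / sin^2] by squeezing.  The same series show
   [Phi p ((p + 1) / 2) z != 0], hence [Q_{p,M}(u) > 0].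

   For the basis property, a periodic spline whose pieces have no term of degree
   [p] is constant, the coefficients of degree [p] of the pieces sum to zero, and
   those of the exponential splines are the characters of [Z / K]. *)

Set Implicit Arguments.
Unset Strict Implicit.
Unset Printing Implicit Defensive.

Import Order.TTheory GRing.Theory Num.Theory.
Import numFieldNormedType.Exports.

Local Open Scope classical_set_scope.
Local Open Scope complex_scope.
Local Open Scope ring_scope.

(** * Complex-valued functions of a real variable *)

(** The function b = z / (z - e^s) satisfies b' = b^2 - b in s, and at s = 0 it satisfies the same
    equation in u up to the factor 2 i pi. One sequence of polynomials in b therefore carries both
    families of derivatives, and they can be compared without a complex variable. The point z = 1
    stands apart: it is a pole of the Euler-Frobenius coefficients, while Phi and Q take the value 1
    there. In the basis, the corresponding function, j = K, is a constant without term of degree p;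
    it supplies exactly the constant that a comparison of the terms of degree p leaves undetermined.
    Integrals are taken over a grid of step 1/(2K), fine enough for both parities of p. Membership
    in the spline space instead needs an integer offset in the argument of Phi: (p+1)/2 when p is
    odd, and (p+2)/2, obtained by a translation by 1/(2K), when p is even. *)

Section ComplexDerivative.
Variable R : realType.
Local Notation Re := complex.Re.
Local Notation Im := complex.Im.
Implicit Types (f g : R -> R[i]) (x : R) (c : R[i]).

Definition is_cderive (f : R -> R[i]) (x : R) (d : R[i]) : Prop :=
  is_derive x 1 (fun y => Re (f y)) (Re d) /\
  is_derive x 1 (fun y => Im (f y)) (Im d).

Lemma Re_add (a b : R[i]) : Re (a + b) = Re a + Re b.
Proof. by case: a b => [? ?] [? ?]. Qed.
Lemma Im_add (a b : R[i]) : Im (a + b) = Im a + Im b.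
Proof. by case: a b => [? ?] [? ?]. Qed.
Lemma Re_mul (a b : R[i]) : Re (a * b) = Re a * Re b - Im a * Im b.
Proof. by case: a b => [? ?] [? ?]. Qed.
Lemma Im_mul (a b : R[i]) : Im (a * b) = Re a * Im b + Im a * Re b.
Proof. by case: a b => [? ?] [? ?]. Qed.

Lemma is_cderive_cst c x : is_cderive (fun=> c) x 0.
Proof. by split; exact: is_derive_cst. Qed.

Lemma is_cderive_eqd f x d d' : is_cderive f x d -> d = d' -> is_cderive f x d'.
Proof. by move=> ? <-. Qed.

Lemma is_cderiveD f g x a b : is_cderive f x a -> is_cderive g x b ->
  is_cderive (fun y => f y + g y) x (a + b).
Proof.
move=> [fr fi] [gr gi]; split.
- under eq_fun do rewrite Re_add; rewrite Re_add; exact: is_deriveD.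
- under eq_fun do rewrite Im_add; rewrite Im_add; exact: is_deriveD.
Qed.

Lemma is_cderiveM f g x a b : is_cderive f x a -> is_cderive g x b ->
  is_cderive (fun y => f y * g y) x (a * g x + f x * b).
Proof.
move=> [fr fi] [gr gi]; split.
- under eq_fun do rewrite Re_mul.
  apply: is_derive_eq.
  by rewrite /GRing.scale /= !(Re_add, Re_mul); ring.
- under eq_fun do rewrite Im_mul.
  apply: is_derive_eq.
  by rewrite /GRing.scale /= !(Im_add, Im_mul); ring.
Qed.

Lemma is_cderiveZ c f x a : is_cderive f x a ->
  is_cderive (fun y => c * f y) x (c * a).
Proof.
move=> fa; apply: is_cderive_eqd (is_cderiveM (is_cderive_cst c x) fa) _.
by rewrite mul0r add0r.
Qed.

Lemma is_cderive_sum (I : Type) (r : seq I) (F : I -> R -> R[i]) (d : I -> R[i]) x :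
  (forall i, is_cderive (F i) x (d i)) ->
  is_cderive (fun y => \sum_(i <- r) F i y) x (\sum_(i <- r) d i).
Proof.
move=> Fd; elim: r => [|i r IHr].
  rewrite big_nil; under eq_fun do rewrite big_nil; exact: is_cderive_cst.
rewrite big_cons; under eq_fun do rewrite big_cons; exact: is_cderiveD.
Qed.

Lemma is_cderive_inv f x a : f x != 0 -> is_cderive f x a ->
  is_cderive (fun y => (f y)^-1) x (- a / f x ^+ 2).
Proof.
move=> fx0 [fr fi]; rewrite expr2 invfM.
(* The components of 1/w are those of conj w / |w|^2, so the squared modulus must not vanish. *)
have n0 : Re (f x) ^+ 2 + Im (f x) ^+ 2 != 0.
  apply: contra fx0; rewrite paddr_eq0 ?sqr_ge0 // !sqrf_eq0 => /andP[/eqP r0 /eqP i0].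
  by rewrite eq_complex r0 i0 /= !eqxx.
have ReV (z : R[i]) : Re z^-1 = Re z * (Re z ^+ 2 + Im z ^+ 2)^-1 by case: z.
have ImV (z : R[i]) : Im z^-1 = - (Im z * (Re z ^+ 2 + Im z ^+ 2)^-1) by case: z.
have dN : is_derive x 1 (fun y => (Re (f y) ^+ 2 + Im (f y) ^+ 2)^-1)
   (- (Re (f x) ^+ 2 + Im (f x) ^+ 2) ^- 2 * (2 * Re (f x) * Re a + 2 * Im (f x) * Im a)).
  apply: is_derive_eq.
  by rewrite /GRing.scale /=; field.
split.
- under eq_fun do rewrite ReV.
  apply: is_derive_eq.
  move: n0; rewrite /GRing.scale /= !(Re_mul, ReV, ImV, Im_mul).
  by case: (f x) (a) => [u v] [s t] /= n0; field.
- under eq_fun do rewrite ImV.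
  apply: is_derive_eq.
  move: n0; rewrite /GRing.scale /= !(Re_mul, ReV, ImV, Im_mul).
  by case: (f x) (a) => [u v] [s t] /= n0; field.
Qed.

Lemma is_cderive_horner (P : {poly R[i]}) f x a : is_cderive f x a ->
  is_cderive (fun y => P.[f y]) x (P^`().[f x] * a).
Proof.
move=> fa; elim/poly_ind: P => [|P c IHP].
  rewrite deriv0 horner0 mul0r; under eq_fun do rewrite horner0.
  exact: is_cderive_cst.
under eq_fun do rewrite hornerMXaddC.
apply: is_cderive_eqd (is_cderiveD (is_cderiveM IHP fa) (is_cderive_cst c x)) _.
by rewrite derivMXaddC !hornerE; ring.
Qed.

Lemma is_cderive_real (f : R -> R) x (d : R) : is_derive x 1 f d ->
  is_cderive (fun y => (f y)%:C) x d%:C.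
Proof. by move=> fd; split=> //=; exact: is_derive_cst. Qed.

Lemma is_cderive_scale (c : R) f x a : is_cderive f (c * x) a ->
  is_cderive (fun y => f (c * y)) x (c%:C * a).
Proof.
move=> [fr fi]; have dc : is_derive x 1 (fun y : R => c * y) c.
  by apply: is_derive_eq; rewrite /GRing.scale /= mulr1.
split.
- have := @is_derive1_comp R (fun y => Re (f y)) (fun y => c * y) x _ _ fr dc.
  by rewrite Re_mul /= mul0r subr0 mulrC.
- have := @is_derive1_comp R (fun y => Im (f y)) (fun y => c * y) x _ _ fi dc.
  by rewrite Im_mul /= mul0r addr0 mulrC.
Qed.

Lemma is_cderive_unique f x a b : is_cderive f x a -> is_cderive f x b -> a = b.
Proof.
move=> [ar ai] [br bi]; apply/eqP; rewrite eq_complex.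
by rewrite -(@derive_val _ _ _ _ _ _ _ ar) -(@derive_val _ _ _ _ _ _ _ ai)
  -(@derive_val _ _ _ _ _ _ _ br) -(@derive_val _ _ _ _ _ _ _ bi) !eqxx.
Qed.

(** Iterated derivatives are local: agreement on an open set suffices. This is what handles
    functions given by different formulas on different intervals. *)
Lemma cderiveE (g : nat -> R -> R[i]) (D : set R) :
  open D -> (forall n x, D x -> is_cderive (g n) x (g n.+1 x)) ->
  forall n f x, {in D, f =1 g 0%N} -> D x -> cderive n f x = g n x.
Proof.
move=> oD gS n f x fg Dx; apply/eqP; rewrite eq_complex /cderive /=.
have key (h : nat -> R -> R) (k : R -> R) : {in D, k =1 h 0%N} ->
    (forall n y, D y -> is_derive y 1 (h n) (h n.+1 y)) ->
    forall m y, D y -> derive1n m k y = h m y.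
  move=> kh hS; elim=> [|m IHm] y Dy /=; first by rewrite kh ?inE.
  rewrite derive1E -(@derive_val _ _ _ _ _ _ _ (hS m y Dy)).
  apply: near_eq_derive.
  by near do apply: IHm; apply: open_nbhs_nbhs.
apply/andP; split; apply/eqP.
- apply: (key (fun m y => Re (g m y))) => // [y yD|m y Dy]; first by rewrite fg.
  by case: (gS m y Dy).
- apply: (key (fun m y => Im (g m y))) => // [y yD|m y Dy]; first by rewrite fg.
  by case: (gS m y Dy).
Unshelve. all: by end_near. Qed.

End ComplexDerivative.

(** * The unit circle *)

Section UnitCircle.
Variable R : realType.
Implicit Types x u : R.

Lemma expi0 : expi 0 = 1 :> R[i].
Proof. by rewrite /expi cos0 sin0. Qed.

Lemma expiD x u : expi (x + u) = expi x * expi u.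
Proof.
by apply/eqP; rewrite eq_complex /= cosD sinD addrC [X in _ && (_ == X)]addrC !eqxx.
Qed.

Lemma conj_expi x : (expi x)^* = expi (- x).
Proof. by rewrite /expi cosN sinN. Qed.

Lemma expi_neq0 x : expi x != 0.
Proof.
apply/eqP => e0; have := cos2Dsin2 x; case: (e0) => -> ->.
by rewrite expr0n addr0 => /eqP; rewrite eq_sym oner_eq0.
Qed.

Lemma expiN x : expi (- x) = (expi x)^-1.
Proof.
by apply: (mulfI (expi_neq0 x)); rewrite -expiD subrr expi0 divff ?expi_neq0.
Qed.

Lemma expiX x n : expi x ^+ n = expi (n%:R * x).
Proof.
elim: n => [|n IHn]; first by rewrite mul0r expi0.
by rewrite exprSr IHn -expiD -natr1 mulrDl mul1r.
Qed.

Lemma expi_2pi : expi (2 * pi) = 1 :> R[i].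
Proof. by rewrite mulr_natl /expi cos2pi sin2pi. Qed.

Lemma expi_natmul_2pi n : expi (n%:R * (2 * pi)) = 1 :> R[i].
Proof. by rewrite -expiX expi_2pi expr1n. Qed.

(* [1 - e^{-2 i x} = 2 i sin x e^{-i x}] *)
Lemma sub1_expi x : 1 - expi (- (2 * x)) = 2 * 'i%C * (sin x)%:C * expi (- x).
Proof.
have -> : - (2 * x) = - x + - x :> R by ring.
rewrite expiD -!conj_expi.
apply/eqP; rewrite eq_complex /=.
have := cos2Dsin2 x; rewrite !expr2 => c2.
by apply/andP; split; apply/eqP; [rewrite -[X in X - _]c2|]; ring.
Qed.

Lemma sin_pi_gt0 u : 0 < u < 1 -> 0 < sin (pi * u).
Proof.
move=> /andP[u0 u1]; apply: sin_gt0_pi.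
by rewrite mulr_gt0 ?pi_gt0 //= gtr_pMr ?pi_gt0.
Qed.

Lemma expi_neq1 u : 0 < u < 1 -> expi (- (2 * pi * u)) != 1.
Proof.
move=> u01; rewrite eq_sym -subr_eq0 -mulrA sub1_expi.
rewrite !mulf_neq0 ?expi_neq0 ?pnatr_eq0 ?neq0Ci //.
by rewrite eq_complex /= gt_eqF ?sin_pi_gt0.
Qed.

End UnitCircle.

(** * Euler-Frobenius coefficients *)

(** Pascal's rule under the sum, the induction step of the Leibniz formula. *)
Lemma sum_pascal (V : zmodType) (n : nat) (w : nat -> V) :
  \sum_(0 <= j < n.+2) w j *+ 'C(n.+1, j) =
  \sum_(0 <= j < n.+1) (w j + w j.+1) *+ 'C(n, j).
Proof.
rewrite big_nat_recl // bin0.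
under eq_bigr do rewrite binS mulrnDr.
under [RHS]eq_bigr do rewrite mulrnDl.
rewrite !big_split /= addrA; congr (_ + _).
by rewrite big_nat_recr //= bin_small // addr0 [RHS]big_nat_recl // bin0.
Qed.

Section EulerFrobeniusNumbers.
Variable R : realType.
Implicit Types (z y : R[i]) (s : R).

(** A function together with all its derivatives. An identity between the zeroth terms of two such
    sequences propagates to all orders, which gives identities between Taylor coefficients. *)
Definition derivation_seq (g : nat -> R -> R[i]) :=
  forall n s, is_cderive (g n) s (g n.+1 s).

Lemma derivation_seq_unique g h : derivation_seq g -> derivation_seq h ->
  g 0%N =1 h 0%N -> forall n, g n =1 h n.
Proof.
move=> dg dh gh0; elim=> [//|n /funext IHn] s.
by apply: is_cderive_unique (dg n s) _; rewrite IHn; exact: dh.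
Qed.

Lemma derivation_seq_cst z : derivation_seq (fun n _ => if n is 0%N then z else 0).
Proof. by move=> [|n] s; exact: is_cderive_cst. Qed.

Lemma derivation_seqD g h : derivation_seq g -> derivation_seq h ->
  derivation_seq (fun n s => g n s + h n s).
Proof. by move=> dg dh n s; exact: is_cderiveD. Qed.

Lemma derivation_seqZ z g : derivation_seq g ->
  derivation_seq (fun n s => z * g n s).
Proof. by move=> dg n s; exact: is_cderiveZ. Qed.

(** Leibniz formula for e^s G(c s). The case c = 1 serves the recurrence of the coefficients, c = 2
    their duplication formula. *)
Lemma derivation_seq_expR (c : R) g : derivation_seq g ->
  derivation_seq (fun n s =>
    (expR s)%:C * \sum_(0 <= j < n.+1) (c ^+ j)%:C * g j (c * s) *+ 'C(n, j)).
Proof.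
move=> dg n s.
have dE : is_cderive (fun x => (expR x)%:C) s (expR s)%:C.
  by apply: is_cderive_real; exact: is_derive_expR.
have dS : is_cderive
    (fun x => \sum_(0 <= j < n.+1) (c ^+ j)%:C * g j (c * x) *+ 'C(n, j)) s
    (\sum_(0 <= j < n.+1) (c ^+ j.+1)%:C * g j.+1 (c * s) *+ 'C(n, j)).
  apply: is_cderive_sum => j; rewrite -mulr_natl.
  under eq_fun do rewrite -mulr_natl; apply: is_cderiveZ.
  have := is_cderiveZ (c ^+ j)%:C (is_cderive_scale (dg j (c * s))).
  by rewrite mulrA -rmorphM /= -exprSr.
apply: is_cderive_eqd (is_cderiveM dE dS) _.
rewrite sum_pascal -mulrDr -big_split /=.
by under eq_bigr do rewrite -mulrnDl.
Qed.

(* [b = z / (z - e^s)] satisfies [b' = b^2 - b], so that its [n]-th derivative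
   is a universal polynomial in [b]. *)
Fixpoint riccati (n : nat) : {poly R[i]} :=
  if n is m.+1 then (riccati m)^`() * ('X^2 - 'X) else 'X.

Lemma is_cderive_riccati n (f : R -> R[i]) (c : R[i]) s :
  is_cderive f s (c * (f s ^+ 2 - f s)) ->
  is_cderive (fun x => (riccati n).[f x]) s (c * (riccati n.+1).[f s]).
Proof.
move=> df; apply: is_cderive_eqd (is_cderive_horner (riccati n) df) _.
by rewrite /= hornerM hornerD hornerN hornerXn hornerX; ring.
Qed.

(** The number z avoids the positive reals, so that 1 / (z - e^s) is smooth on the whole real
    line. *)
Definition off_exp z := forall s, z - (expR s)%:C != 0.

(** The n-th derivative of (z - 1) / (z - e^s), which is (z - 1) / z times b = z / (z - e^s). *)
Definition EFder z (n : nat) (s : R) : R[i] :=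
  (z - 1) / z * (riccati n).[z / (z - (expR s)%:C)].

Lemma derivation_seq_EFder z : z != 0 -> off_exp z -> derivation_seq (EFder z).
Proof.
move=> z0 ze n s; rewrite /EFder; apply: is_cderiveZ.
rewrite -[X in is_cderive _ _ X]mul1r; apply: is_cderive_riccati.
have dE : is_cderive (fun x => (expR x)%:C) s (expR s)%:C.
  by apply: is_cderive_real; exact: is_derive_expR.
have := is_cderiveD (is_cderive_cst z s) (is_cderiveZ (-1) dE).
move=> dE'; apply: is_cderive_eqd.
  apply: is_cderiveZ; apply: is_cderive_inv; first exact: ze.
  by under eq_fun do rewrite -mulN1r; exact: dE'.
by move: (ze s) => zs /=; field.
Qed.

(* [Pi_n(z) / (z - 1)^n] *)
Definition EFcoef z n : R[i] := (z - 1) / z * (riccati n).[z / (z - 1)].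

Lemma EFder0 z n : EFder z n 0 = EFcoef z n.
Proof. by rewrite /EFder expR0. Qed.

Lemma EFder0E z s : z != 0 -> EFder z 0 s = (z - 1) / (z - (expR s)%:C).
Proof. by move=> z0; rewrite /EFder /= hornerX mulrA divfK. Qed.

Lemma EulerFrobeniusE z n : z != 0 -> off_exp z ->
  EulerFrobenius n z = (z - 1) ^+ n * EFcoef z n.
Proof.
move=> z0 ze; rewrite /EulerFrobenius -EFder0; congr (_ * _).
apply: (@cderiveE R (EFder z) setT) => // [|m s _|s _].
- exact: openT.
- exact: derivation_seq_EFder.
- by rewrite EFder0E.
Qed.

Lemma EFcoef0 z : z != 0 -> z - 1 != 0 -> EFcoef z 0 = 1.
Proof. by move=> z0 z1; rewrite -EFder0 EFder0E // expR0 divff. Qed.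

(** The product of z - e^s with the generating function is the constant z - 1, so its n-th
    derivative at 0 vanishes for n > 0. *)
Lemma EFcoef_rec z n : z != 0 -> off_exp z -> (0 < n)%N ->
  \sum_(0 <= j < n.+1) EFcoef z j *+ 'C(n, j) = z * EFcoef z n.
Proof.
move=> z0 ze n0; have dG := derivation_seq_EFder z0 ze.
pose g m s := z * EFder z m s + -1 *
  ((expR s)%:C * \sum_(0 <= j < m.+1) (1 ^+ j)%:C * EFder z j (1 * s) *+ 'C(m, j)).
have dg : derivation_seq g.
  apply: derivation_seqD; apply: derivation_seqZ => //.
  exact: derivation_seq_expR.
have : g n 0 = 0.
  rewrite (derivation_seq_unique dg (derivation_seq_cst (z - 1))).
    by case: n n0.
  move=> s; rewrite /g big_nat1 bin0 expr0 !mul1r mulr1n mulN1r -mulrBl.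
  by rewrite EFder0E // mulrC divfK.
rewrite /g expR0 mulN1r (rmorph1 (@real_complex R)) (mul1r (\sum_(_ <= _ < _) _)) EFder0 => /eqP; rewrite subr_eq0 => /eqP ->.
by apply: eq_bigr => j _; rewrite expr1n mulr0 EFder0 mul1r.
Qed.

(* [2 e^s (y^2 - 1) / (y^2 - e^{2s}) = (y + 1) (y - 1) / (y - e^s) +
   (1 - y) (- y - 1) / (- y - e^s)] *)
Lemma EFcoef_dup y n : y != 0 -> off_exp y -> off_exp (- y) -> off_exp (y ^+ 2) ->
  2 * \sum_(0 <= j < n.+1) 2 ^+ j * EFcoef (y ^+ 2) j *+ 'C(n, j) =
  (y + 1) * EFcoef y n + (1 - y) * EFcoef (- y) n.
Proof.
move=> y0 ye nye y2e; have ny0 : - y != 0 by rewrite oppr_eq0.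
have y20 : y ^+ 2 != 0 by rewrite expf_neq0.
pose g m s := 2 *
  ((expR s)%:C * \sum_(0 <= j < m.+1) (2 ^+ j)%:C * EFder (y ^+ 2) j (2 * s) *+ 'C(m, j)).
pose h m s := (y + 1) * EFder y m s + (1 - y) * EFder (- y) m s.
have dg : derivation_seq g.
  by apply/derivation_seqZ/derivation_seq_expR/derivation_seq_EFder.
have dh : derivation_seq h.
  by apply: derivation_seqD; apply/derivation_seqZ/derivation_seq_EFder.
have : g n 0 = h n 0.
  apply: (derivation_seq_unique dg dh) => s.
  have s2 : 2 * s = s + s by rewrite mulr_natl mulr2n.
  rewrite /g /h big_nat1 bin0 expr0 mul1r mulr1n !EFder0E // s2 expRD rmorphM /=.
  have := y2e (s + s); rewrite expRD rmorphM /=.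
  have := nye s; have := ye s; set w := (expR s)%:C => ? ? ?.
  by field; apply/and3P; split.
rewrite /g /h expR0 (rmorph1 (@real_complex R)) (mul1r (\sum_(_ <= _ < _) _)) !EFder0 => <-; congr (_ * _).
by apply: eq_bigr => j _; rewrite mulr0 EFder0 rmorphXn rmorph_nat.
Qed.

Lemma off_exp_expi (x : R) : expi x != 1 -> off_exp (expi x).
Proof.
move=> x1 s; apply: contra x1; rewrite subr_eq0 => /eqP[c s0].
have : expR s ^+ 2 = 1 by rewrite -c -(cos2Dsin2 x) s0 expr0n addr0.
move=> /eqP; rewrite sqrf_eq1 => /orP[/eqP e1|/eqP eN1].
  by rewrite /expi c s0 e1.
by have := expR_gt0 s; rewrite eN1; lra.
Qed.

End EulerFrobeniusNumbers.

(** * Series of reciprocal powers *)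

Section InverseSquares.
Variable R : realType.
Implicit Types (x u : R).

Lemma le_at_0_of_derive (f df : R -> R) (b : R) : 0 <= b ->
  (forall x, is_derive x 1 f (df x)) -> (forall x, 0 < x < b -> 0 <= df x) ->
  f 0 <= f b.
Proof.
move=> b0 fd df0; apply: (@ger0_derive1_ndecr _ f 0 b) => // [x|].
- rewrite in_itv /= => xb; rewrite derive1E.
  by rewrite (@derive_val _ _ _ _ _ _ _ (fd x)) df0.
- apply/continuous_subspaceT => x; apply: differentiable_continuous.
  by apply/derivable1_diffP; have [] := fd x.
Qed.

Lemma sin_le_id x : 0 <= x -> sin x <= x.
Proof.
move=> x0; rewrite -subr_ge0 -[leLHS](_ : 0 - sin 0 = 0); last by rewrite sin0 subr0.
by apply: (@le_at_0_of_derive (fun y => y - sin y) (fun y => 1 - cos y)).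
Qed.

Lemma mul_cos_le_sin x : 0 <= x <= pi -> x * cos x <= sin x.
Proof.
move=> /andP[x0 xpi]; rewrite -subr_ge0.
rewrite -[leLHS](_ : sin 0 - 0 * cos 0 = 0); last by rewrite sin0 mul0r subr0.
apply: (@le_at_0_of_derive (fun y => sin y - y * cos y) (fun y => y * sin y)) => // y.
  by apply: is_derive_eq; rewrite /GRing.scale /=; ring.
move=> /andP[y0 yx]; rewrite mulr_ge0 ?ltW // sin_gt0_pi // y0 /=.
exact: lt_le_trans yx xpi.
Qed.

(** Squaring x cos x <= sin x <= x and replacing cos^2 by 1 - sin^2. The error 1 does not depend on
    x, hence becomes negligible after rescaling. *)
Lemma inv_sin2_bounds x : 0 < `|x| < pi / 2 ->
  x ^- 2 <= sin x ^- 2 <= x ^- 2 + 1.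
Proof.
wlog x0 : x / 0 < x => [hw|].
  move=> h; have [x0|x0|x0] := ltgtP x 0.
  - have := hw (- x); rewrite oppr_gt0 normrN sinN !sqrrN; exact.
  - exact: hw.
  - by move: h; rewrite x0 normr0 ltxx.
rewrite gtr0_norm // => /andP[_ xpi].
have pi0 := pi_gt0 R; have s0 : 0 < sin x by rewrite sin_gt0_pi // x0 /=; lra.
have c0 : 0 <= cos x by rewrite cos_ge0_pihalf //; lra.
have xc := @mul_cos_le_sin x; have sx := @sin_le_id x (ltW x0).
have {}xc : x * cos x <= sin x by apply: xc; lra.
have q0 : 0 < sin x ^+ 2 by rewrite exprn_gt0.
have p0 : 0 < x ^+ 2 by rewrite exprn_gt0.
rewrite lef_pV2 ?posrE // ler_sqr ?nnegrE ?(ltW s0) ?(ltW x0) // sx /=.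
rewrite -[leLHS]mul1r ler_pdivrMr //.
have -> : (x ^- 2 + 1) * sin x ^+ 2 = (sin x ^+ 2 + x ^+ 2 * sin x ^+ 2) / x ^+ 2.
  by field; rewrite gt_eqF.
rewrite ler_pdivlMr // mul1r -lerBlDr -[X in X - _]mulr1 -mulrBr -cos2sin2.
by rewrite -exprMn ler_sqr ?nnegrE ?mulr_ge0 ?(ltW s0) ?(ltW x0).
Qed.

Lemma inv_sin2_dup x : sin x != 0 ->
  4 * sin x ^- 2 = sin (x / 2) ^- 2 + sin (x / 2 + pi / 2) ^- 2.
Proof.
move=> sx; have e : sin x = 2 * sin (x / 2) * cos (x / 2).
  by rewrite {1}(_ : x = x / 2 + x / 2) ?sinD; [ring | field].
move: sx; rewrite sinDpihalf e => /[dup] sx.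
rewrite mulf_eq0 negb_or mulf_eq0 negb_or => /andP[/andP[_ s0] c0].
have := cos2Dsin2 (x / 2) => cs.
transitivity ((cos (x / 2) ^+ 2 + sin (x / 2) ^+ 2) / (sin (x / 2) * cos (x / 2)) ^+ 2).
  by rewrite cs; field; rewrite s0 c0.
by field; rewrite s0 c0.
Qed.

Lemma sinDnatpi x n : sin (x + n%:R * pi) ^+ 2 = sin x ^+ 2.
Proof.
elim: n => [|n IHn]; first by rewrite mul0r addr0.
by rewrite -natr1 mulrDl mul1r addrA sinDpi sqrrN.
Qed.

(** The duplication formula applied to every term of level n: term l splits into the terms l and l +
    2^n of level n + 1. *)
Lemma inv_sin2_dyadic n u : 0 < u < 1 ->
  \sum_(0 <= l < 2 ^ n) sin (pi * (u + l%:R) / (2 ^ n)%:R) ^- 2 =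
  (2 ^ n)%:R ^+ 2 * sin (pi * u) ^- 2.
Proof.
move=> /andP[u0 u1]; elim: n => [|n IHn].
  by rewrite expn0 big_nat1 addr0 divr1 expr1n mul1r.
have M0 : (0 : R) < (2 ^ n)%:R by rewrite ltr0n expn_gt0.
rewrite {1}expnS mul2n -addnn (@big_cat_nat _ _ _ (2 ^ n)%N) ?leq_addr //=.
rewrite -{2}(add0n (2 ^ n)%N) big_addn addnK -big_split /=.
rewrite expnS natrM exprMn -[RHS]mulrA -IHn big_distrr /=.
apply: eq_big_nat => l /andP[_ l2].
have lM : l.+1%:R <= (2 ^ n)%:R :> R by rewrite ler_nat.
rewrite -natrX (_ : (2 ^ 2)%:R = 4 :> R) // inv_sin2_dup; last first.
  rewrite gt_eqF // -mulrA sin_pi_gt0 // divr_gt0 ?ltr_wpDr //=.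
  by rewrite ltr_pdivrMr // mul1r (lt_le_trans _ lM) // -natr1 addrC ltrD2l.
by congr (sin _ ^- 2 + sin _ ^- 2); [|rewrite natrD]; field; rewrite gt_eqF.
Qed.

Definition recip_series k (a : nat -> R) u := series (fun l => (u + a l) ^- k).

(** The two halves of the bilateral series, split as in [Q]. *)
Definition nat_up (l : nat) : R := l%:R.
Definition nat_down (l : nat) : R := - l.+1%:R.

(** Since sin^2 has period pi, the upper half of the dyadic sum can be moved to negative indices.
    The arguments then lie in (-pi/2, pi/2), where [inv_sin2_bounds] applies. *)
Lemma inv_sin2_window n u : 0 < u < 1 ->
  \sum_(0 <= l < 2 ^ n) (sin (pi * (u + nat_up l) / (2 ^ n.+1)%:R) ^- 2 +
    sin (pi * (u + nat_down l) / (2 ^ n.+1)%:R) ^- 2) =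
  (2 ^ n.+1)%:R ^+ 2 * sin (pi * u) ^- 2.
Proof.
move=> u01; have e : (2 ^ n.+1 = 2 ^ n + 2 ^ n)%N by rewrite expnS mul2n addnn.
rewrite -inv_sin2_dyadic // big_split /=.
rewrite [RHS](@big_cat_nat _ _ _ (2 ^ n)%N) ?leq_exp2l //=; congr (_ + _).
have shift (F : nat -> R) :
    \sum_(2 ^ n <= l < 2 ^ n.+1) F l = \sum_(0 <= l < 2 ^ n) F (l + 2 ^ n)%N.
  by rewrite -{1}[(2 ^ n)%N]add0n big_addn e addnK.
(* In reversed order, the index 2^(n+1) - (l+1) faces -(l+1); the arguments differ by pi. *)
rewrite [RHS]shift [RHS]big_nat_rev /= add0n.
apply: eq_big_nat => l /andP[_ l2]; congr (_ ^-1).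
rewrite -[LHS](@sinDnatpi _ 1) mul1r; congr (sin _ ^+ 2).
rewrite /nat_down natrD natrB // expnS natrM.
by field; rewrite pnatr_eq0 -lt0n expn_gt0.
Qed.

(** With M = 2^(n+1), each of the M terms is known up to an error in [0, 1]; dividing the sum by M^2
    leaves a total error of at most 1/M. *)
Lemma recip2_window_bounds n u w : 0 < u < 1 ->
  w = pi ^- 2 * (recip_series 2 nat_up u (2 ^ n)%N + recip_series 2 nat_down u (2 ^ n)%N) ->
  w <= sin (pi * u) ^- 2 <= w + (2 ^ n.+1)%:R^-1.
Proof.
move=> u01 w_def; set M : R := (2 ^ n.+1)%:R.
have M0 : 0 < M by rewrite ltr0n expn_gt0.
have M20 : 0 < M ^+ 2 by rewrite exprn_gt0.
have pi0 := pi_gt0 R; have pi20 : 0 < (pi : R) ^+ 2 by rewrite exprn_gt0.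
have MN : M = 2 * (2 ^ n)%:R by rewrite /M expnS natrM.
have key (t : R) : t != 0 -> `|t| < (2 ^ n)%:R ->
    M ^+ 2 * (pi ^- 2 * t ^- 2) <= sin (pi * t / M) ^- 2 <= M ^+ 2 * (pi ^- 2 * t ^- 2) + 1.
  move=> t0 tM; have -> : M ^+ 2 * (pi ^- 2 * t ^- 2) = (pi * t / M) ^- 2.
    by rewrite !exprMn exprVn !invfM invrK mulrC.
  apply: inv_sin2_bounds; rewrite normr_gt0 !mulf_neq0 ?invr_eq0 ?(gt_eqF pi0) ?(gt_eqF M0) //=.
  rewrite !normrM normfV !(gtr0_norm M0) (gtr0_norm pi0) ltr_pdivrMr // MN.
  by rewrite mulrA divfK ?pnatr_eq0 // ltr_pM2l.
have key2 : forall l, (l < 2 ^ n)%N ->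
    M ^+ 2 * (pi ^- 2 * ((u + nat_up l) ^- 2 + (u + nat_down l) ^- 2)) <=
    sin (pi * (u + nat_up l) / M) ^- 2 + sin (pi * (u + nat_down l) / M) ^- 2 <=
    M ^+ 2 * (pi ^- 2 * ((u + nat_up l) ^- 2 + (u + nat_down l) ^- 2)) + 2.
  move=> l lN; have lM : l.+1%:R <= (2 ^ n)%:R :> R by rewrite ler_nat.
  have l0 : (0 : R) <= l%:R by [].
  move: lM u01; rewrite -natr1 => lM /andP[u0 u1].
  have := key (u + l%:R); have := key (u - (l%:R + 1)).
  rewrite /nat_up /nat_down -natr1.
  have -> : `|u + l%:R| = u + l%:R by rewrite gtr0_norm //; lra.
  have -> : `|u - (l%:R + 1)| = l%:R + 1 - u by rewrite ltr0_norm; lra.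
  have t1 : u - (l%:R + 1) != 0 by rewrite lt_eqF //; lra.
  have t2 : u + l%:R != 0 by rewrite gt_eqF //; lra.
  have t3 : l%:R + 1 - u < (2 ^ n)%:R by lra.
  have t4 : u + l%:R < (2 ^ n)%:R by lra.
  move=> /(_ t1 t3)/andP[d1 d2] /(_ t2 t4)/andP[e1 e2].
  rewrite (mulrDr (pi ^- 2)) (mulrDr (M ^+ 2)); apply/andP; split; first exact: lerD.
  by apply: le_trans (lerD e2 d2) _; rewrite addrACA (_ : 1 + 1 = 2).
have -> : w = M ^- 2 * \sum_(0 <= l < 2 ^ n)
    (M ^+ 2 * (pi ^- 2 * ((u + nat_up l) ^- 2 + (u + nat_down l) ^- 2))).
  rewrite -!big_distrr /= mulKf ?(gt_eqF M20) // big_split /=.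
  by rewrite w_def /recip_series !seriesEnat.
have s2 : sin (pi * u) ^- 2 = M ^- 2 * (M ^+ 2 * sin (pi * u) ^- 2).
  by rewrite mulKf ?(gt_eqF M20).
have -> : M^-1 = M ^- 2 * \sum_(0 <= l < 2 ^ n) 2.
  by rewrite sumr_const_nat subn0 -[2 *+ _]mulr_natr -MN expr2 invfM mulfVK ?(gt_eqF M0).
rewrite s2 -(inv_sin2_window n u01) -mulrDr -big_split /=.
rewrite !ler_pM2l ?invr_gt0 //; apply/andP; split; apply: ler_sum_nat => l /andP[_ /key2];
  by case/andP.
Qed.

End InverseSquares.

(** * Convergence, termwise differentiation and sign of the series *)

Section RecipSeries.
Variable R : realType.
Implicit Types (u h d x : R) (k n l : nat).

(** The terms are nonnegative and n <= 2^n, so the n-th partial sum is below the window of size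
    2^n. *)
Lemma recip2_bounded (u : R) : 0 < u < 1 -> forall n,
  recip_series 2 (@nat_up R) u n + recip_series 2 (@nat_down R) u n <=
  pi ^+ 2 * sin (pi * u) ^- 2.
Proof.
move=> u01 n; have pi20 : 0 < (pi : R) ^+ 2 by rewrite exprn_gt0 ?pi_gt0.
have /andP[h _] := recip2_window_bounds (n := n) u01 erefl.
rewrite -ler_pdivrMl //; apply: le_trans h; rewrite ler_pM2l ?invr_gt0 // lerD //.
- apply: (nondecreasing_series (P := xpredT)) => [l _ _|]; first by rewrite invr_ge0 sqr_ge0.
  exact/ltnW/ltn_expl.
- apply: (nondecreasing_series (P := xpredT)) => [l _ _|]; first by rewrite invr_ge0 sqr_ge0.
  exact/ltnW/ltn_expl.
Qed.

Lemma recip2_ge0 (a : nat -> R) u n : 0 <= recip_series 2 a u n.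
Proof. by apply: sumr_ge0 => l _; rewrite invr_ge0 sqr_ge0. Qed.

Lemma cvg_recip2 (a : nat -> R) u C :
  (forall n, recip_series 2 a u n <= C) -> cvgn (recip_series 2 a u).
Proof.
move=> aC; apply: nondecreasing_is_cvgn; last by exists C => _ [n _ <-].
by apply: (nondecreasing_series (P := xpredT)) => l _ _; rewrite invr_ge0 sqr_ge0.
Qed.

Lemma cvg_recip2_up u : 0 < u < 1 -> cvgn (recip_series 2 (@nat_up R) u).
Proof.
move=> u01; apply: cvg_recip2 => n; apply: le_trans (recip2_bounded u01 n).
by rewrite lerDl recip2_ge0.
Qed.

Lemma cvg_recip2_down u : 0 < u < 1 -> cvgn (recip_series 2 (@nat_down R) u).
Proof.
move=> u01; apply: cvg_recip2 => n; apply: le_trans (recip2_bounded u01 n).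
by rewrite lerDr recip2_ge0.
Qed.

Definition recip_sum k u : R :=
  limn (recip_series k (@nat_up R) u) + limn (recip_series k (@nat_down R) u).

(** Convergence being known, the limit may be computed along the subsequence 2^n, where the window
    bounds pinch it. *)
Lemma recip_sum2 u : 0 < u < 1 -> recip_sum 2 u = pi ^+ 2 * sin (pi * u) ^- 2.
Proof.
move=> u01; have pi20 : 0 < (pi : R) ^+ 2 by rewrite exprn_gt0 ?pi_gt0.
have up := cvg_recip2_up u01; have down := cvg_recip2_down u01.
pose w n := pi ^- 2 * (recip_series 2 (@nat_up R) u (2 ^ n)%N + recip_series 2 (@nat_down R) u (2 ^ n)%N).
have e2 : (fun n => 2 ^ n)%N @ \oo --> \oo.
  move=> P [N _ NP]; exists N => // n /= Nn; apply: NP => /=.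
  by apply: leq_trans Nn _; exact/ltnW/ltn_expl.
have cw : w @ \oo --> pi ^- 2 * recip_sum 2 u.
  apply: cvgM; first exact: cvg_cst.
  by apply: cvgD; [apply: (cvg_comp _ _ e2 up)|apply: (cvg_comp _ _ e2 down)].
have ci : (fun n => w n + (2 ^ n.+1)%:R^-1) @ \oo --> pi ^- 2 * recip_sum 2 u + 0.
  apply: cvgD => //.
  rewrite (_ : (fun n => _) = geometric (2^-1) (2^-1)); last first.
    by apply/funext => n /=; rewrite natrX exprS invfM exprVn.
  apply: cvg_geometric; rewrite ger0_norm ?invr_ge0 //; lra.
rewrite addr0 in ci.
have c : (fun=> sin (pi * u) ^- 2) @ \oo --> pi ^- 2 * recip_sum 2 u.
  apply: (squeeze_cvgr _ cw ci); near=> n.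
  exact: (recip2_window_bounds u01 erefl).
have := cvg_unique _ c (cvg_cst _); move=> /(_ (@norm_hausdorff _ _)) <-.
by rewrite mulrA divff ?mul1r // gt_eqF.
Unshelve. all: by end_near. Qed.

(** Comparison with exponent 2: |x|^-k <= d^-(k-2) x^-2 as soon as |x| >= d. *)
Lemma cvg_recip_series k (a : nat -> R) u d : 0 < d ->
  (forall l, d <= `|u + a l|) -> cvgn (recip_series 2 a u) ->
  (2 <= k)%N -> cvgn (recip_series k a u).
Proof.
move=> d0 da c2 k2; apply: normed_cvg.
apply: (@series_le_cvg _ _ (d ^- (k - 2) *: (fun l => (u + a l) ^- 2))) => [l|l|l|].
- exact: normr_ge0.
- by rewrite mulr_ge0 // invr_ge0 ?sqr_ge0 // exprn_ge0 ?(ltW d0).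
- have x0 : 0 < `|u + a l| by exact: lt_le_trans (da l).
  rewrite /GRing.scale /= normfV normrX -{1}(subnK k2) exprD invfM.
  rewrite -[X in _ <= _ * X]ger0_norm ?invr_ge0 ?sqr_ge0 // normfV normrX.
  rewrite ler_pM2r ?invr_gt0 ?exprn_gt0 // lef_pV2 ?posrE ?exprn_gt0 //.
  by rewrite lerXn2r ?nnegrE ?(ltW d0) // ltW.
- exact: is_cvg_seriesZ.
Qed.

(** The constant is uniform in x, and the factor x^-2 keeps the bound summable over x = u + l. In
    the induction the remainder of order k+1 is 1/(x+h) times that of order k plus one explicit
    term, and |1/(x+h)| <= 2/d. *)
Lemma recip_taylor_bound k d : 0 < d -> exists2 C, 0 <= C & forall x h,
  d <= `|x| -> `|h| <= d / 2 ->
  `|(x + h) ^- k - x ^- k + k%:R * h * x ^- k.+1| <= C * h ^+ 2 * x ^- 2.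
Proof.
move=> d0; elim: k => [|k [C C0 IHk]].
  by exists 0 => // x h _ _; rewrite expr0 invr1 subrr !mul0r addr0 normr0.
exists (2 / d * (C + k.+1%:R / d ^+ k)) => [|x h dx hd].
  by rewrite mulr_ge0 ?addr_ge0 ?divr_ge0 ?exprn_ge0 ?(ltW d0).
have x0 : x != 0 by rewrite -normr_gt0; exact: lt_le_trans dx.
have xhd : d / 2 <= `|x + h|.
  have := ler_normB (x + h) h; rewrite addrK; lra.
have xh0 : x + h != 0 by rewrite -normr_gt0; apply: lt_le_trans xhd; lra.
have -> : (x + h) ^- k.+1 - x ^- k.+1 + k.+1%:R * h * x ^- k.+2 =
    (x + h)^-1 * ((x + h) ^- k - x ^- k + k%:R * h * x ^- k.+1 +
    k.+1%:R * h ^+ 2 * (x ^- k * x ^- 2)).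
  rewrite -!exprVn !exprS -natr1; set X := x^-1 ^+ k; set Y := (x + h)^-1 ^+ k.
  by field; rewrite x0.
have -> : 2 / d * (C + k.+1%:R / d ^+ k) * h ^+ 2 * x ^- 2 =
    2 / d * ((C + k.+1%:R / d ^+ k) * h ^+ 2 * x ^- 2) by rewrite !mulrA.
rewrite normrM; apply: ler_pM => //.
  by rewrite normfV -[2 / d]invf_div lef_pV2 ?posrE ?divr_gt0 // normr_gt0.
apply: le_trans (ler_normD _ _) _; rewrite !mulrDl lerD ?IHk //.
pose c := k.+1%:R * (h ^+ 2 * x ^- 2).
have c0 : 0 <= c by rewrite /c mulr_ge0 // divr_ge0 ?sqr_ge0.
have -> : k.+1%:R * h ^+ 2 * (x ^- k * x ^- 2) = x ^- k * c by rewrite /c; ring.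
have -> : k.+1%:R * d ^- k * h ^+ 2 * x ^- 2 = d ^- k * c by rewrite /c; ring.
rewrite normrM (ger0_norm c0) ler_wpM2r // normfV normrX.
rewrite lef_pV2 ?posrE ?exprn_gt0 ?normr_gt0 //.
by rewrite lerXn2r ?nnegrE ?(ltW d0).
Qed.

Lemma is_derive_quadratic (f : R -> R) u L C (e : R) : 0 < e ->
  (forall h, `|h| <= e -> `|f (u + h) - f u - h * L| <= C * h ^+ 2) ->
  is_derive u 1 f L.
Proof.
move=> e0 fL.
have c : (fun h => h^-1 *: (f (h *: 1 + u) - f u)) @ 0^' --> L.
  apply/cvgrPdist_le => eps eps0.
  have C1 : 0 < `|C| + 1 by rewrite ltr_wpDl.
  near=> h.
  have h0 : h != 0 by near: h; exact: nbhs_dnbhs_neq.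
  have he : `|h| <= e by near: h; apply: dnbhs0_le.
  have hC : `|h| <= eps / (`|C| + 1) by near: h; apply: dnbhs0_le; rewrite divr_gt0.
  have := fL h he; rewrite /GRing.scale /= mulr1 (addrC h) => fh.
  have -> : L - h^-1 * (f (u + h) - f u) = - (h^-1 * (f (u + h) - f u - h * L)).
    by field.
  rewrite normrN normrM normfV ler_pdivrMl ?normr_gt0 //.
  apply: le_trans fh _; rewrite -real_normK ?num_real // expr2 mulrCA ler_wpM2l //.
  apply: le_trans (_ : (`|C| + 1) * `|h| <= _).
    by rewrite ler_wpM2r // (le_trans (ler_norm _)) // lerDl.
  by rewrite mulrC -ler_pdivlMr.
have dv : derivable f u 1 by apply/cvg_ex; exists L.
by apply: DeriveDef => //; apply: cvg_lim.
Unshelve. all: by end_near. Qed.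

(** Termwise differentiation: the first-order Taylor remainders of the terms add up to O(h^2). *)
Lemma is_derive_recip_lim k (a : nat -> R) u d : 0 < d -> (2 <= k)%N ->
  (forall l, d <= `|u + a l|) ->
  (forall v, `|v - u| <= d / 2 -> cvgn (recip_series 2 a v)) ->
  is_derive u 1 (fun v => limn (recip_series k a v))
    (- k%:R * limn (recip_series k.+1 a u)).
Proof.
move=> d0 k2 da cv.
have d20 : 0 < d / 2 by lra.
have [C C0 hC] := recip_taylor_bound k d0.
apply: (@is_derive_quadratic _ _ _ (C * limn (recip_series 2 a u)) (d / 2)) => // h hd.
have c2 : cvgn (recip_series 2 a u) by apply: cv; rewrite subrr normr0 ltW.
have dah l : d / 2 <= `|u + h + a l|.
  have := ler_normB (u + h + a l) h; rewrite addrAC addrK.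
  have := da l; lra.
have ck : cvgn (recip_series k a u) by exact: cvg_recip_series da c2 k2.
have ck1 : cvgn (recip_series k.+1 a u) by apply: cvg_recip_series da c2 _ => //; exact: leqW.
have ch : cvgn (recip_series k a (u + h)).
  by apply: cvg_recip_series dah _ k2 => //; apply: cv; rewrite addrC addKr.
(* The Taylor remainder of the l-th term. *)
pose t l := (u + h + a l) ^- k - (u + a l) ^- k + (k%:R * h) * (u + a l) ^- k.+1.
have tE : series t = (fun n => recip_series k a (u + h) n - recip_series k a u n +
    (k%:R * h) * recip_series k.+1 a u n).
  apply/funext => n; rewrite /recip_series !seriesEnat /= big_distrr /= -sumrB -big_split /=.
  by [].
have ct : series t @ \oo --> limn (recip_series k a (u + h)) - limn (recip_series k a u) +
    (k%:R * h) * limn (recip_series k.+1 a u).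
  rewrite tE; apply: cvgD; first exact: cvgB.
  by apply: cvgM => //; exact: cvg_cst.
have -> : limn (recip_series k a (u + h)) - limn (recip_series k a u) -
    h * (- k%:R * limn (recip_series k.+1 a u)) = limn (series t).
  by rewrite (cvg_lim _ ct) //; ring.
have tl l : `|t l| <= (C * h ^+ 2) * (u + a l) ^- 2.
  by rewrite /t (addrAC u h); apply: hC.
have cn : cvgn [normed series t].
  apply: (@series_le_cvg _ _ ((C * h ^+ 2) *: (fun l => (u + a l) ^- 2))) => [l|l|l|].
  - exact: normr_ge0.
  - exact: le_trans (normr_ge0 _) (tl l).
  - exact: tl.
  - exact: is_cvg_seriesZ.
apply: le_trans (lim_series_norm cn) _.
have -> : C * limn (recip_series 2 a u) * h ^+ 2 =
    limn (series ((C * h ^+ 2) *: (fun l => (u + a l) ^- 2))).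
  by rewrite lim_seriesZ // mulrAC.
by apply: lim_series_le => //; exact: is_cvg_seriesZ.
Qed.

(** The distance from u to the integers serves as the separation d of the preceding lemmas. *)
Lemma dist_nat_up u l : 0 < u < 1 -> Num.min u (1 - u) <= `|u + nat_up R l|.
Proof.
move=> /andP[u0 u1]; have l0 : (0 : R) <= l%:R by [].
by rewrite /nat_up gtr0_norm ?ge_min ?lerDl ?l0 // ltr_wpDr.
Qed.

Lemma dist_nat_down u l : 0 < u < 1 -> Num.min u (1 - u) <= `|u + nat_down R l|.
Proof.
move=> /andP[u0 u1]; have l0 : (0 : R) <= l%:R by [].
rewrite /nat_down -natr1 ltr0_norm; last by lra.
by rewrite ge_min; apply/orP; right; lra.
Qed.

Lemma min_dist_gt0 u : 0 < u < 1 -> 0 < Num.min u (1 - u).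
Proof. by move=> /andP[u0 u1]; rewrite lt_min u0 subr_gt0. Qed.

Lemma min_dist_nbhs u v : 0 < u < 1 -> `|v - u| <= Num.min u (1 - u) / 2 -> 0 < v < 1.
Proof.
move=> /andP[u0 u1] h.
have m1 : Num.min u (1 - u) <= u by rewrite ge_min lexx.
have m2 : Num.min u (1 - u) <= 1 - u by rewrite ge_min lexx orbT.
move: h; rewrite ler_norml => /andP[h1 h2]; lra.
Qed.

Lemma cvg_recip_up k u : 0 < u < 1 -> (2 <= k)%N -> cvgn (recip_series k (@nat_up R) u).
Proof.
move=> u01; apply: cvg_recip_series (min_dist_gt0 u01) _ _; last exact: cvg_recip2_up.
by move=> l; exact: dist_nat_up.
Qed.

Lemma cvg_recip_down k u : 0 < u < 1 -> (2 <= k)%N -> cvgn (recip_series k (@nat_down R) u).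
Proof.
move=> u01; apply: cvg_recip_series (min_dist_gt0 u01) _ _; last exact: cvg_recip2_down.
by move=> l; exact: dist_nat_down.
Qed.

Lemma is_derive_recip_sum k u : 0 < u < 1 -> (2 <= k)%N ->
  is_derive u 1 (recip_sum k) (- k%:R * recip_sum k.+1 u).
Proof.
move=> u01 k2; rewrite /recip_sum mulrDr; apply: is_deriveD.
- apply: is_derive_recip_lim (min_dist_gt0 u01) k2 _ _ => [l|v]; first exact: dist_nat_up.
  by move=> /(min_dist_nbhs u01); exact: cvg_recip2_up.
- apply: is_derive_recip_lim (min_dist_gt0 u01) k2 _ _ => [l|v]; first exact: dist_nat_down.
  by move=> /(min_dist_nbhs u01); exact: cvg_recip2_down.
Qed.

Lemma recip_sum_even_gt0 m u : 0 < u < 1 -> 0 < recip_sum (2 * m.+1) u.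
Proof.
move=> u01; have k2 : (2 <= 2 * m.+1)%N by rewrite leq_pmulr.
have t0 (a : nat -> R) l : 0 <= (u + a l) ^- (2 * m.+1).
  by rewrite invr_ge0 exprM exprn_ge0 ?sqr_ge0.
rewrite ltr_pwDl //.
  apply: (@lt_le_trans _ _ (recip_series (2 * m.+1) (@nat_up R) u 1)).
    rewrite /recip_series seriesEnat /= big_nat1 invr_gt0 /nat_up addr0 exprn_gt0 //.
    by case/andP: u01.
  apply: nondecreasing_cvgn_le; last exact: cvg_recip_up.
  exact: (nondecreasing_series (P := xpredT)).
apply: limr_ge; first exact: cvg_recip_down.
by near=> n; apply: sumr_ge0.
Unshelve. all: by end_near. Qed.

(* For odd [k] every term [(u + l)^-k] is decreasing in [u]. *)
Lemma recip_sum_odd_decr m u v : 0 < u < 1 -> 0 < v < 1 -> u < v ->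
  recip_sum (2 * m + 3) v < recip_sum (2 * m + 3) u.
Proof.
move=> u01 v01 uv; set k := (2 * m + 3)%N.
have k2 : (2 <= k)%N by rewrite /k; lia.
have kodd : odd k by rewrite /k oddD mul2n odd_double.
have uvpos (x y : R) : 0 < x -> x < y -> y ^- k < x ^- k.
  move=> x0 xy; rewrite ltf_pV2 ?posrE ?exprn_gt0 ?(lt_trans x0 xy) //.
  rewrite ltrXn2r ?nnegrE ?(ltW x0) ?(ltW (lt_trans x0 xy)) ?xy ?andbT //.
  by rewrite /k addn3.
case/andP: (u01) => u0 u1; case/andP: (v01) => v0 v1.
have l0 l : (0 : R) <= l%:R by [].
apply: ltr_leD.
  rewrite -subr_gt0.
  have c : series (fun l => (u + nat_up R l) ^- k - (v + nat_up R l) ^- k) @ \oo -->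
      limn (recip_series k (@nat_up R) u) - limn (recip_series k (@nat_up R) v).
    rewrite (_ : series _ = recip_series k (@nat_up R) u - recip_series k (@nat_up R) v).
      by apply: cvgB; exact: cvg_recip_up.
    by apply/funext => n; rewrite /recip_series fctE !seriesEnat /= sumrB.
  have p l : 0 < (u + nat_up R l) ^- k - (v + nat_up R l) ^- k.
    by rewrite subr_gt0 uvpos ?ltrD2r // /nat_up ltr_wpDr.
  rewrite -(cvg_lim _ c) //; apply: lt_le_trans (p 0%N) _.
  apply: le_trans (nondecreasing_cvgn_le _ _ 1%N); last by apply/cvg_ex; eexists; exact: c.
    by rewrite seriesEnat /= big_nat1.
  by apply: (nondecreasing_series (P := xpredT)) => l _ _; rewrite ltW.
apply: lim_series_le => [||l]; [exact: cvg_recip_down..|].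
have N (x : R) : (- x) ^- k = - x ^- k by rewrite exprNn -signr_odd kodd expr1 mulN1r invrN.
have e x : x + nat_down R l = - (l%:R + 1 - x) by rewrite /nat_down -natr1; ring.
by rewrite !e !N lerN2 ltW // uvpos //; have := l0 l; lra.
Qed.

End RecipSeries.

(** * From derivatives in s to derivatives in u *)

Section RiccatiSeries.
Variable R : realType.
Implicit Types (u v x : R).

Lemma is_cderive_near (f g : R -> R[i]) x d : (\near x, f x = g x) ->
  is_cderive f x d -> is_cderive g x d.
Proof.
move=> fg [fr fi]; split.
- by apply: near_eq_is_derive fr; near=> y; congr complex.Re; near: y.
- by apply: near_eq_is_derive fi; near=> y; congr complex.Im; near: y.
Unshelve. all: by end_near. Qed.

Lemma is_cderive_expi (c : R) x :
  is_cderive (fun y => expi (c * y)) x (c%:C * 'i%C * expi (c * x)).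
Proof.
split; rewrite /expi /=; apply: is_derive_eq; rewrite /GRing.scale /=; ring.
Qed.

Definition zexp u : R[i] := expi (- (2 * pi * u)).

Lemma zexp_neq0 u : zexp u != 0. Proof. exact: expi_neq0. Qed.

Lemma zexp_neq1 u : 0 < u < 1 -> zexp u - 1 != 0.
Proof. by move=> u01; rewrite subr_eq0 expi_neq1. Qed.

Lemma off_exp_zexp u : 0 < u < 1 -> off_exp (zexp u).
Proof. by move=> u01; apply: off_exp_expi; exact: expi_neq1. Qed.

(** The Riccati equation in the variable u: differentiating a polynomial [riccati] in b = z / (z -
    1) yields the next one times 2 i pi. *)
Lemma is_cderive_zexp_ratio u : 0 < u < 1 ->
  is_cderive (fun v => zexp v / (zexp v - 1)) u
   (2 * (pi)%:C * 'i%C * ((zexp u / (zexp u - 1)) ^+ 2 - zexp u / (zexp u - 1))).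
Proof.
move=> u01; have z1 := zexp_neq1 u01.
have dz : is_cderive zexp u (- (2 * pi)%:C * 'i%C * zexp u).
  have -> : zexp = (fun v => expi (- (2 * pi) * v)).
    by apply/funext => v; rewrite /zexp mulNr.
  by have := is_cderive_expi (- (2 * pi)) u; rewrite rmorphN.
have dz1 := is_cderiveD dz (is_cderive_cst (-1) u).
apply: is_cderive_eqd (is_cderiveM dz (is_cderive_inv z1 dz1)) _.
rewrite rmorphM /= (_ : 2%:C = 2); last by rewrite (rmorph_nat (@real_complex R) 2).
by field.
Qed.

(* [(z - 1)^2 / z = (z^(1/2) - z^(-1/2))^2] *)
Lemma zexp_sin2 u : (zexp u - 1) ^+ 2 = - 4 * (sin (pi * u))%:C ^+ 2 * zexp u.
Proof.
rewrite -sqrrN opprB /zexp -mulrA sub1_expi !exprMn.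
have -> : expi (- (pi * u)) ^+ 2 = expi (- (2 * (pi * u))).
  by rewrite expiX; congr expi; ring.
by rewrite sqr_i; ring.
Qed.

(** This is -1 / (2 i pi), where the sign comes from differentiating a negative power of u + l. *)
Definition ipi2 : R[i] := 'i%C * ((2 * pi)^-1)%:C.

(** For n = 0, b^2 - b = z / (z - 1)^2 = -1 / (4 sin^2 (pi u)), which [recip_sum2] turns into the
    series. The step differentiates both sides in u. *)
Lemma riccati_series n u : 0 < u < 1 ->
  (riccati R n.+1).[zexp u / (zexp u - 1)] =
  n.+1`!%:R * ipi2 ^+ n.+2 * (recip_sum n.+2 u)%:C.
Proof.
have pi0 : (pi : R) != 0 by rewrite gt_eqF ?pi_gt0.
have ipiE : ipi2 ^+ 2 = (- (2 * pi) ^- 2)%:C.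
  by rewrite /ipi2 exprMn sqr_i mulN1r -rmorphXn -rmorphN /= exprVn.
elim: n u => [|n IHn] u u01.
  have z1 := zexp_neq1 u01; have z0 := zexp_neq0 u.
  rewrite /= derivX mul1r hornerD hornerN hornerXn hornerX mul1r.
  rewrite recip_sum2 // ipiE -rmorphM.
  have s0 := sin_pi_gt0 u01; move: (zexp_sin2 u) => zs.
  have s1 : (sin (pi * u))%:C ^+ 2 != 0 :> R[i].
    by rewrite expf_neq0 // eq_complex /= gt_eqF.
  have alg (x y : R) : x != 0 -> y != 0 ->
      - (2 * x) ^- 2 * (x ^+ 2 * y ^- 2) = - (4 * y ^+ 2)^-1.
    by move=> x0 y0; field; rewrite x0 y0.
  rewrite alg // ?gt_eqF //.
  transitivity (zexp u / (zexp u - 1) ^+ 2); first by field.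
  rewrite zs rmorphN fmorphV rmorphM rmorphXn /= (rmorph_nat (@real_complex R) 4).
  by field; rewrite z0 -(sqrf_eq0 _%:C) s1.
have du := is_cderive_riccati n.+1 (is_cderive_zexp_ratio u01).
have dS : is_cderive (fun v => n.+1`!%:R * ipi2 ^+ n.+2 * (recip_sum n.+2 v)%:C) u
    (n.+1`!%:R * ipi2 ^+ n.+2 * (- n.+2%:R * recip_sum n.+3 u)%:C).
  by apply/is_cderiveZ/is_cderive_real/is_derive_recip_sum.
have {}dS : is_cderive (fun v => (riccati R n.+1).[zexp v / (zexp v - 1)]) u
    (n.+1`!%:R * ipi2 ^+ n.+2 * (- n.+2%:R * recip_sum n.+3 u)%:C).
  apply: is_cderive_near dS; near=> v; rewrite IHn //.
  by near: v; apply: near_in_itvoo; rewrite in_itv.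
have := is_cderive_unique du dS.
set A := _.[_]; rewrite rmorphM rmorphN /= (rmorph_nat (@real_complex R)) => e.
have c0 : 2 * pi%:C * 'i%C != 0 :> R[i].
  by rewrite !mulf_neq0 ?pnatr_eq0 ?fmorph_eq0 ?neq0Ci.
apply: (mulfI c0); rewrite e.
have ii : 2 * pi%:C * 'i%C * ipi2 = -1.
  rewrite /ipi2 fmorphV rmorphM /= (rmorph_nat (@real_complex R) 2).
  transitivity ('i%C ^+ 2 : R[i]); last by rewrite sqr_i.
  have piC : pi%:C != 0 :> R[i] by rewrite fmorph_eq0.
  by move: piC; set y := pi%:C; move: y => y y0; field.
rewrite [RHS](_ : _ = (2 * pi%:C * 'i%C * ipi2) *
  (n.+2`!%:R * ipi2 ^+ n.+2 * (recip_sum n.+3 u)%:C)); last by rewrite (exprS _ n.+2); ring.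
by rewrite ii (factS n.+1) natrM; ring.
Unshelve. all: by end_near. Qed.

End RiccatiSeries.

(** * Polynomial pieces of the exponential splines *)

Section PolynomialIntegral.
Variable F : numFieldType.
Implicit Types (P Q : {poly F}) (a b c : F).

Definition pprim P : {poly F} := \poly_(i < (size P).+1) (P`_i.-1 / i%:R).

Lemma deriv_pprim P : (pprim P)^`() = P.
Proof.
apply/polyP => i; rewrite coef_deriv coef_poly ltnS.
case: ltnP => [iP|Pi]; last by rewrite mul0rn nth_default.
by rewrite -[LHS]mulr_natr divfK // pnatr_eq0.
Qed.

(** A formal integral: integration by parts and substitution over the complex numbers become
    polynomial algebra. *)
Definition pint P a b : F := (pprim P).[b] - (pprim P).[a].

Lemma deriv_eq0_polyC P : P^`() = 0 -> P = (P`_0)%:P.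
Proof.
move=> P0; apply/polyP => -[|i]; rewrite coefC //=.
have := congr1 (fun Q : {poly F} => Q`_i) P0.
by rewrite coef_deriv coef0 => /eqP; rewrite mulrn_eq0 => /eqP.
Qed.

Lemma pint_deriv Q a b : pint Q^`() a b = Q.[b] - Q.[a].
Proof.
have : (pprim Q^`() - Q)^`() = 0 by rewrite derivB deriv_pprim subrr.
move=> /deriv_eq0_polyC e; rewrite /pint.
have -> : pprim Q^`() = Q + ((pprim Q^`() - Q)`_0)%:P by rewrite -e addrC subrK.
by rewrite !hornerD !hornerC; ring.
Qed.

Lemma pintD P Q a b : pint (P + Q) a b = pint P a b + pint Q a b.
Proof.
rewrite -{1}(deriv_pprim P) -{1}(deriv_pprim Q) -derivD pint_deriv /pint.
by rewrite !hornerD; ring.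
Qed.

Lemma pintZ c P a b : pint (c *: P) a b = c * pint P a b.
Proof.
by rewrite -{1}(deriv_pprim P) -derivZ pint_deriv /pint !hornerZ mulrBr.
Qed.

Lemma pint_split P a b c : pint P a b + pint P b c = pint P a c.
Proof. by rewrite /pint addrC subrKA. Qed.

Lemma pint_comp P k m a b : k != 0 ->
  pint (P \Po (k *: 'X + m%:P)) a b = k^-1 * pint P (k * a + m) (k * b + m).
Proof.
move=> k0; have -> : P \Po (k *: 'X + m%:P) =
    (k^-1 *: (pprim P \Po (k *: 'X + m%:P)))^`().
  rewrite derivZ deriv_comp deriv_pprim derivD derivZ derivX derivC addr0.
  by rewrite alg_polyC mulrC mul_polyC scalerA mulVf ?scale1r.
rewrite pint_deriv !hornerZ !horner_comp !hornerD !hornerZ !hornerX !hornerC.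
by rewrite -mulrBr.
Qed.

End PolynomialIntegral.

(** * The polynomials F_p and the integrals of |F_m|^2 *)

Section ExponentialSplinePolynomial.
Variable R : realType.
Implicit Types (z : R[i]) (u : R) (p m n : nat).

Definition efpoly p z : {poly R[i]} :=
  if z == 1 then 1 else
  ((1 - z^-1) ^+ p / p`!%:R) *:
    \sum_(0 <= j < p.+1) (EFcoef z j *+ 'C(p, j)) *: 'X^(p - j).

Lemma deriv_efpoly p z : (efpoly p.+1 z)^`() = (1 - z^-1) *: efpoly p z.
Proof.
rewrite /efpoly; case: eqP => [->|/eqP z1]; first by rewrite invr1 subrr scale0r derivC.
rewrite derivZ raddf_sum /= big_nat_recr //= subnn expr0 derivZ derivC scaler0 addr0.
rewrite !scaler_sumr; apply: eq_big_nat => j /andP[_ jp].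
rewrite derivZ derivXn subSn //= -[_ *+ (p - j).+1]scaler_nat !scalerA; congr (_ *: _).
have bin : ('C(p.+1, j) * (p - j).+1 = p.+1 * 'C(p, j))%N.
  by rewrite mulnC -subSn // -mul_bin_down.
have p0 : p.+1%:R != 0 :> R[i] by rewrite pnatr_eq0.
have f0 : p`!%:R != 0 :> R[i] by rewrite pnatr_eq0 -lt0n fact_gt0.
transitivity ((1 - z^-1) ^+ p.+1 / p.+1`!%:R * EFcoef z j * ('C(p.+1, j) * (p - j).+1)%:R).
  by rewrite natrM -[_ *+ 'C(_, _)]mulr_natr; ring.
rewrite bin natrM factS natrM exprS -[_ *+ 'C(p, j)]mulr_natr.
move: (1 - z^-1) (_ ^+ p) (EFcoef z j) => x y w; field.
by rewrite f0 addrC natr1 p0.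
Qed.

Lemma horner0_efpoly p z : z != 1 ->
  (efpoly p z).[0] = (1 - z^-1) ^+ p / p`!%:R * EFcoef z p.
Proof.
move=> z1; rewrite /efpoly (negbTE z1) hornerZ horner_sum big_nat_recr //=.
rewrite subnn expr0 hornerZ hornerC mulr1 binn mulr1n big_nat big1 ?add0r // => j /andP[_ jp].
by rewrite hornerZ hornerXn expr0n subn_eq0 leqNgt jp mulr0.
Qed.

(** This is the recurrence [EFcoef_rec], and it says that Phi is continuous at the integers. The
    degree must be positive: F_0 = 1 satisfies it only for z = 1. *)
Lemma horner1_efpoly p z : z != 0 -> z = 1 \/ off_exp z ->
  (efpoly p.+1 z).[1] = z * (efpoly p.+1 z).[0].
Proof.
move=> z0 zE; have [z1|z1] := eqVneq z 1.
  by rewrite /efpoly z1 eqxx !hornerC mul1r.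
case: zE => [z1'|ze]; first by rewrite z1' eqxx in z1.
rewrite horner0_efpoly // mulrCA -(@EFcoef_rec _ z p.+1) //.
rewrite /efpoly (negbTE z1) hornerZ horner_sum; congr (_ * _).
by apply: eq_bigr => j _; rewrite hornerZ hornerXn expr1n mulr1.
Qed.

Lemma efpoly0 z : z != 0 -> efpoly 0 z = 1.
Proof.
move=> z0; rewrite /efpoly; case: eqP => // /eqP z1.
by rewrite big_nat1 !expr0 fact0 divr1 EFcoef0 ?subr_eq0 // bin0 mulr1n !scale1r.
Qed.

Lemma size_efpoly p z : (size (efpoly p z) <= p.+1)%N.
Proof.
rewrite /efpoly; case: eqP => _; first by rewrite size_poly1.
apply: leq_trans (size_scale_leq _ _) _; apply: leq_trans (size_sum _ _ _) _.
apply/bigmax_leqP_seq => j _ _; apply: leq_trans (size_scale_leq _ _) _.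
by rewrite size_polyXn ltnS leq_subr.
Qed.

Lemma PhiE p n x z : z != 0 -> z = 1 \/ off_exp z -> 0 <= x < 1 ->
  Phi p (n%:R + x) z = z ^+ n * (efpoly p z).[x%:C].
Proof.
move=> z0 zE x01.
have fl : Num.floor (n%:R + x) = n%:Z.
  by apply: floor_def; rewrite -pmulrn intrD -pmulrn lerDl ltrD2l.
rewrite /Phi /efpoly /fracpart fl -pmulrn [n%:R + x]addrC addrK.
case: eqP => [->|/eqP z1]; first by rewrite expr1n hornerC mulr1.
case: zE => [/eqP|ze]; first by rewrite (negbTE z1).
rewrite -exprnP -mulrA; congr (_ * _).
rewrite hornerZ horner_sum !big_distrr /=; apply: eq_bigr => j _.
rewrite hornerZ hornerXn EulerFrobeniusE // -mulr_natl.
have f0 : p`!%:R != 0 :> R[i] by rewrite pnatr_eq0 -lt0n fact_gt0.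
have zj : (z - 1) ^+ j != 0 by rewrite expf_neq0 // subr_eq0.
by move: ((z - 1) ^+ j) zj p`!%:R f0 => ? ? ? ?; field; apply/andP.
Qed.

Lemma zexp1_or_off u : 0 < u <= 1 -> zexp u = 1 \/ off_exp (zexp u).
Proof.
move=> /andP[u0]; rewrite le_eqVlt => /orP[/eqP->|u1].
  by left; rewrite /zexp mulr1 expiN expi_2pi invr1.
by right; apply: off_exp_zexp; rewrite u0.
Qed.

Lemma conj_zexp u : (zexp u)^* = (zexp u)^-1.
Proof. by rewrite conj_expi -expiN. Qed.

(** On the real line, [P * pconj P] is the polynomial |P|^2. *)
Definition pconj (P : {poly R[i]}) : {poly R[i]} := map_poly Num.conj P.

Lemma horner_pconj P (x : R) : (pconj P).[x%:C] = (P.[x%:C])^*.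
Proof.
have {1}-> : x%:C = (x%:C)^* :> R[i] by apply/esym/CrealP; rewrite complex_real.
by rewrite horner_map.
Qed.

Lemma deriv_pconj_efpoly p u :
  (pconj (efpoly p.+1 (zexp u)))^`() = (1 - zexp u) *: pconj (efpoly p (zexp u)).
Proof.
rewrite /pconj deriv_map deriv_efpoly map_polyZ /=; congr (_ *: _).
by rewrite rmorphB rmorph1 fmorphV /= conj_zexp invrK.
Qed.

(** Integration by parts. The boundary term vanishes, since the product of F_{p+1} with the
    conjugate of F_{n+1} is multiplied by z / z = 1 from 0 to 1; the factor is - (1 - z) / (1 - 1/z)
    = z. *)
Lemma pint_efpoly_shift p n u : 0 < u < 1 ->
  pint (efpoly p (zexp u) * pconj (efpoly n.+1 (zexp u))) 0 1 =
  zexp u * pint (efpoly p.+1 (zexp u) * pconj (efpoly n (zexp u))) 0 1.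
Proof.
move=> u01; set z := zexp u; have z0 : z != 0 by exact: zexp_neq0.
have z1 : z - 1 != 0 by exact: zexp_neq1.
have zE : z = 1 \/ off_exp z by right; exact: off_exp_zexp.
have h0 P : (pconj P).[0] = (P.[0])^* by exact: (horner_pconj P 0).
have h1 P : (pconj P).[1] = (P.[1])^* by exact: (horner_pconj P 1).
have : pint (efpoly p.+1 z * pconj (efpoly n.+1 z))^`() 0 1 = 0.
  rewrite pint_deriv !hornerM h0 h1 !horner1_efpoly // rmorphM /= conj_zexp.
  by rewrite mulrACA divff // mul1r subrr.
rewrite derivM deriv_efpoly deriv_pconj_efpoly -/z -scalerAl -scalerAr pintD !pintZ.
move=> /eqP; rewrite addr_eq0 => /eqP e.
have z1' : 1 - z^-1 != 0 by rewrite -[1](divff z0) -{2}[z^-1]mul1r -mulrBl mulf_neq0 ?invr_eq0.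
apply: (mulfI z1'); rewrite e mulrA -mulNr; congr (_ * _).
by rewrite mulrBl mul1r mulVf // opprB.
Qed.

(** Shifting m times leaves z^m times the integral of F_{2m}; its primitive F_{2m+1} / (1 - 1/z)
    grows by z F_{2m+1}(0) over [0, 1]. *)
Lemma pint_efpoly_norm m u : 0 < u < 1 ->
  pint (efpoly m (zexp u) * pconj (efpoly m (zexp u))) 0 1 =
  zexp u ^+ m.+1 * (efpoly (2 * m).+1 (zexp u)).[0].
Proof.
move=> u01; set z := zexp u; have z0 : z != 0 by exact: zexp_neq0.
have z1 : z - 1 != 0 by exact: zexp_neq1.
have zE : z = 1 \/ off_exp z by right; exact: off_exp_zexp.
have shift k : (k <= m)%N -> pint (efpoly m z * pconj (efpoly m z)) 0 1 =
    z ^+ k * pint (efpoly (m + k) z * pconj (efpoly (m - k) z)) 0 1.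
  elim: k => [|k IHk] km; first by rewrite expr0 mul1r addn0 subn0.
  rewrite IHk; last exact: ltnW.
  have -> : (m - k = (m - k.+1).+1)%N by rewrite subnSK.
  by rewrite pint_efpoly_shift // exprSr -[RHS]mulrA addnS.
rewrite (shift m) // subnn efpoly0 // addnn -mul2n /pconj rmorph1 mulr1 exprSr -mulrA; congr (_ * _).
have z1' : 1 - z^-1 != 0 by rewrite -[1](divff z0) -{2}[z^-1]mul1r -mulrBl mulf_neq0 ?invr_eq0.
apply: (mulfI z1'); rewrite -pintZ -deriv_efpoly pint_deriv horner1_efpoly //.
by rewrite [RHS]mulrA [in RHS]mulrBl mul1r mulVf // mulrBl mul1r.
Qed.

Lemma EFcoef_series n u : 0 < u < 1 ->
  EFcoef (zexp u) n.+1 = (1 - (zexp u)^-1) * (n.+1`!%:R * ipi2 R ^+ n.+2 * (recip_sum n.+2 u)%:C).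
Proof.
by move=> u01; rewrite /EFcoef riccati_series // mulrBl divff ?zexp_neq0 // mul1r.
Qed.

(** The powers group into m + 1 factors z (1 - 1/z)^2 [ipi2]^2. By [zexp_sin2] each is (-4 sin^2 (pi
    u)) (-1 / (4 pi^2)). *)
Lemma pint_efpoly_recip m u : 0 < u < 1 ->
  zexp u ^+ m.+1 * (efpoly (2 * m).+1 (zexp u)).[0] =
  ((sin (pi * u) / pi) ^+ (2 * m.+1) * recip_sum (2 * m.+1) u)%:C.
Proof.
move=> u01; set z := zexp u; have z0 : z != 0 by exact: zexp_neq0.
have z1 : z != 1 by rewrite -subr_eq0 zexp_neq1.
have pi0 : (pi : R) != 0 by rewrite gt_eqF ?pi_gt0.
rewrite horner0_efpoly // EFcoef_series // -/z.
have f0 : (2 * m).+1`!%:R != 0 :> R[i] by rewrite pnatr_eq0 -lt0n fact_gt0.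
have m2 : (2 * m.+1 = (2 * m).+2)%N by rewrite mulnS.
rewrite m2; set S := recip_sum _ _.
transitivity ((z * (1 - z^-1) ^+ 2 * ipi2 R ^+ 2) ^+ m.+1 * S%:C).
  rewrite (exprMn _ (z * _)) (exprMn _ z) -!exprM m2 (exprSr (1 - z^-1) (2 * m).+1).
  move: f0; move: ((2 * m).+1`!%:R : R[i]) => f f0.
  by move: (1 - z^-1) (z ^+ m.+1) (ipi2 R) => a b w; field.
rewrite rmorphM; congr (_ * _); rewrite -m2 exprM rmorphXn; congr (_ ^+ _).
have -> : z * (1 - z^-1) ^+ 2 = (z - 1) ^+ 2 / z by field.
rewrite zexp_sin2 mulfK // /ipi2 exprMn sqr_i.
rewrite rmorphXn rmorphM !fmorphV rmorphM /= (rmorph_nat (@real_complex R) 2).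
have : pi%:C != 0 :> R[i] by rewrite fmorph_eq0.
by move: pi%:C (sin _)%:C => x y x0; field.
Qed.

End ExponentialSplinePolynomial.

(** * Q-functions *)

Section QFunctions.
Variable R : realType.
Implicit Types (u x : R) (m n p : nat).

Lemma sinc_even m u x : x != 0 -> sin (pi * x) ^+ 2 = sin (pi * u) ^+ 2 ->
  sinc (pi * x) ^+ (2 * m + 2) = (sin (pi * u) / pi) ^+ (2 * m.+1) * x ^- (2 * m.+1).
Proof.
move=> x0 sx; have pi0 : (pi : R) != 0 by rewrite gt_eqF ?pi_gt0.
rewrite /sinc mulf_eq0 (negbTE x0) (negbTE pi0) /=.
have -> : (2 * m + 2 = 2 * m.+1)%N by lia.
rewrite -exprVn -exprMn !(exprM _ 2 m.+1); congr (_ ^+ _).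
by rewrite !exprMn !exprVn -sx exprMn invfM mulrA.
Qed.

Lemma Q_recip m u : 0 < u < 1 ->
  Q (2 * m) u = (sin (pi * u) / pi) ^+ (2 * m.+1) * recip_sum (2 * m.+1) u.
Proof.
move=> u01; case/andP: (u01) => u0 u1; rewrite /Q /recip_sum mulrDr.
have l0 l : (0 : R) <= l%:R by [].
have k2 : (2 <= 2 * m.+1)%N by lia.
have lim (a b : nat -> R) : (forall l, b l = u + a l) ->
    (forall l, b l != 0) -> (forall l, sin (pi * b l) ^+ 2 = sin (pi * u) ^+ 2) ->
    cvgn (recip_series (2 * m.+1) a u) ->
    limn (series (fun l => sinc (pi * b l) ^+ (2 * m + 2))) =
    (sin (pi * u) / pi) ^+ (2 * m.+1) * limn (recip_series (2 * m.+1) a u).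
  move=> ba b0 bs ca; rewrite -[RHS]lim_seriesZ //; congr (limn (series _)).
  by apply/funext => l; rewrite (sinc_even _ (b0 l) (bs l)) ba.
congr (_ + _).
- apply: lim => [//|l|l|]; last exact: cvg_recip_up.
  + by rewrite gt_eqF // ltr_wpDr.
  + by rewrite mulrDr [pi * l%:R]mulrC sinDnatpi.
- apply: (lim (@nat_down R)) => [//|l|l|]; last exact: cvg_recip_down.
  + by rewrite lt_eqF // -natr1; have := l0 l; lra.
  + by rewrite -(sinDnatpi (pi * (u - _)) l.+1); congr (sin _ ^+ 2); ring.
Qed.

Lemma sin_natpi n : sin (n%:R * pi) = 0 :> R.
Proof.
by apply/eqP; rewrite -sqrf_eq0 -[_ * _]add0r sinDnatpi sin0 expr0n.
Qed.

(** Only the index -1, the first term of the descending half, meets sinc at 0; at the other integer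
    multiples of pi, sinc vanishes. *)
Lemma Q1 m : Q m (1 : R) = 1.
Proof.
have pi0 : (pi : R) != 0 by rewrite gt_eqF ?pi_gt0.
have m2 : (0 < m + 2)%N by rewrite addn2.
have sinc0 l : sinc (l.+1%:R * pi : R) = 0.
  by rewrite /sinc mulf_eq0 (negbTE pi0) pnatr_eq0 /= sin_natpi mul0r.
have sincN x : sinc (- x) = sinc x :> R.
  by rewrite /sinc oppr_eq0 sinN invrN mulrNN.
rewrite /Q (_ : (fun l => sinc (pi * (1 + l%:R)) ^+ (m + 2)) = fun=> 0); last first.
  by apply/funext => l; rewrite [1 + _]addrC natr1 mulrC sinc0 expr0n (gtn_eqF m2).
rewrite (_ : series (fun=> 0) = fun=> 0); last first.
  by apply/funext => n; rewrite seriesEnat /= big1.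
rewrite lim_cst // add0r; apply: cvg_lim => //.
rewrite -(cvg_shiftS _); apply: cvg_near_cst; near=> n.
rewrite seriesEnat /= big_nat_recl //= subrr mulr0 big1 => [|l _].
  by rewrite /sinc eqxx expr1n addr0.
rewrite -[l.+2]addn1 natrD opprD addrCA subrr addr0 mulrN mulrC sincN sinc0.
by rewrite expr0n (gtn_eqF m2).
Unshelve. all: by end_near. Qed.

Lemma Q_gt0 m u : 0 < u <= 1 -> 0 < Q (2 * m) u.
Proof.
move=> /andP[u0]; rewrite le_eqVlt => /orP[/eqP->|u1]; first by rewrite Q1.
have u01 : 0 < u < 1 by rewrite u0.
by rewrite Q_recip // mulr_gt0 ?recip_sum_even_gt0 // exprn_gt0 // divr_gt0 ?sin_pi_gt0 ?pi_gt0.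
Qed.

Lemma zexp1 : zexp (1 : R) = 1.
Proof. by rewrite /zexp mulr1 expiN expi_2pi invr1. Qed.

Lemma pint_efpoly_Q m u : 0 < u <= 1 ->
  pint (efpoly m (zexp u) * pconj (efpoly m (zexp u))) 0 1 = (Q (2 * m) u)%:C.
Proof.
move=> /andP[u0]; rewrite le_eqVlt => /orP[/eqP->|u1].
  rewrite Q1 zexp1 /efpoly eqxx /pconj rmorph1 mulr1 -(derivX _) pint_deriv !hornerX.
  by rewrite subr0.
have u01 : 0 < u < 1 by rewrite u0.
by rewrite pint_efpoly_norm // pint_efpoly_recip // Q_recip.
Qed.

(** For p even, F_p(1/2) is a nonzero multiple of the left side of [EFcoef_dup] with y^2 = z. Its
    right side is a nonzero multiple of S(u/2) - S((u+1)/2), where S is the series of exponent p +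
    1; that exponent is odd, so S is strictly decreasing. *)
Lemma efpoly_half_neq0 r u : 0 < u < 1 ->
  (efpoly (2 * r.+1) (zexp u)).[(2^-1 : R)%:C] != 0.
Proof.
move=> u01; case/andP: (u01) => u0 u1; set p := (2 * r.+1)%N.
(* The square roots of z are y and -y, the latter belonging to the parameter (u + 1) / 2. *)
pose y := zexp (u / 2).
have y01 : 0 < u / 2 < 1 by apply/andP; split; lra.
have y01' : 0 < (u + 1) / 2 < 1 by apply/andP; split; lra.
have y2 : y ^+ 2 = zexp u.
  by rewrite /y /zexp expiX; congr expi; field.
have ny : - y = zexp ((u + 1) / 2).
  have -> : zexp ((u + 1) / 2) = y * expi (- pi).
    by rewrite /y /zexp -expiD; congr expi; field.
  have -> : expi (- pi) = -1 :> R[i].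
    by apply/eqP; rewrite eq_complex /= cosN sinN cospi sinpi !eqxx.
  by rewrite mulrN1.
have y0 : y != 0 by exact: zexp_neq0.
have z1 : zexp u != 1 by rewrite -subr_eq0 zexp_neq1.
have ze := off_exp_zexp u01.
have := @EFcoef_dup R y p y0 (off_exp_zexp y01); rewrite {1}ny y2.
move=> /(_ (off_exp_zexp y01') ze).
have pS : p = p.-1.+1 by [].
rewrite {2 3}pS ny !EFcoef_series // -ny -pS.
set c := p`!%:R * ipi2 R ^+ p.+1.
have c0 : c != 0.
  rewrite mulf_neq0 ?pnatr_eq0 -?lt0n ?fact_gt0 // expf_neq0 //.
  by rewrite mulf_neq0 ?neq0Ci // fmorph_eq0 invr_eq0 mulf_neq0 // gt_eqF ?pi_gt0.
clearbody c.
set s1 := recip_sum _ _; set s2 := recip_sum _ _ => e.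
have s12 : s1 - s2 != 0.
  rewrite gt_eqF // subr_gt0 /s1 /s2 /p.
  have -> : ((2 * r.+1).+1 = 2 * r + 3)%N by lia.
  by apply: recip_sum_odd_decr => //; lra.
rewrite /efpoly (negbTE z1) hornerZ mulf_neq0 //.
  rewrite mulf_neq0 ?invr_eq0 ?pnatr_eq0 -?lt0n ?fact_gt0 // expf_neq0 //.
  by rewrite subr_eq0 eq_sym invr_eq1.
rewrite horner_sum.
have -> : \sum_(0 <= j < p.+1) ((EFcoef (zexp u) j *+ 'C(p, j)) *: 'X^(p - j)).[(2^-1 : R)%:C] =
    2 ^- p * \sum_(0 <= j < p.+1) 2 ^+ j * EFcoef (zexp u) j *+ 'C(p, j).
  rewrite big_distrr /=; apply: eq_big_nat => j /andP[_ jp].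
  rewrite hornerZ hornerXn fmorphV (rmorph_nat (@real_complex R) 2) exprVn.
  have -> : 2 ^- (p - j) = 2 ^- p * 2 ^+ j :> R[i].
    have t0 n : 2 ^+ n != 0 :> R[i] by rewrite expf_neq0 // pnatr_eq0.
    by apply: (mulIf (t0 (p - j)%N)); rewrite mulVf // -mulrA -exprD subnKC ?mulVf.
  rewrite -[EFcoef _ _ *+ _]mulr_natr -[2 ^+ j * _ *+ _]mulr_natr; ring.
rewrite mulf_neq0 ?invr_eq0 ?expf_neq0 ?pnatr_eq0 //.
rewrite -(mulrI_eq0 _ (mulfI (_ : 2 != 0))) ?pnatr_eq0 // e.
have -> : (y + 1) * ((1 - y^-1) * (c * s1%:C)) + (1 - y) * ((1 - (- y)^-1) * (c * s2%:C)) =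
    (y ^+ 2 - 1) / y * c * (s1 - s2)%:C.
  by rewrite rmorphB invrN; field.
by rewrite y2 !mulf_neq0 ?invr_eq0 ?fmorph_eq0 ?zexp_neq1.
Qed.

(** For p = 2m + 1 the argument is an integer, and F_p(0) is Q_{2m}(u) > 0 up to a power of z. For p
    even it is a half-integer. *)
Lemma Phi_center_neq0 p n u : (0 < p)%N -> 0 < u <= 1 ->
  Phi p (n%:R + p.+1%:R / 2) (zexp u) != 0.
Proof.
move=> p0 u01; have zE := zexp1_or_off u01; have z0 := zexp_neq0 u.
case/andP: (u01) => u0; rewrite le_eqVlt => /orP[/eqP ->|u1].
  by rewrite zexp1 /Phi eqxx oner_neq0.
have u01' : 0 < u < 1 by rewrite u0.
have [podd|peven] := boolP (odd p).
  have [m pm] : exists m, p = (2 * m).+1.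
    by exists p./2; rewrite mul2n -[LHS]odd_double_half podd.
  have -> : n%:R + p.+1%:R / 2 = (n + m.+1)%:R + 0 :> R.
    by rewrite pm (_ : (2 * m).+2 = 2 * m.+1)%N ?natrM ?natrD; [field | lia].
  rewrite PhiE ?lexx ?ltr01 // mulf_neq0 ?expf_neq0 // pm.
  have := pint_efpoly_recip m u01'; rewrite -Q_recip // => e.
  apply: contraTneq (Q_gt0 m u01) => F0; move: e; rewrite F0 mulr0 => /esym/eqP.
  by rewrite fmorph_eq0 => /eqP ->; rewrite ltxx.
have [r pr] : exists r, p = (2 * r.+1)%N.
  exists p./2.-1; rewrite prednK; last by rewrite half_gt0; case: p p0 peven => [|[]].
  by rewrite mul2n -[LHS]odd_double_half (negbTE peven).
have -> : n%:R + p.+1%:R / 2 = (n + r.+1)%:R + 2^-1 :> R.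
  by rewrite -natr1 pr natrM natrD; field.
rewrite PhiE //; last by apply/andP; split; lra.
by rewrite mulf_neq0 ?expf_neq0 // pr efpoly_half_neq0.
Qed.

Lemma sqmod_ge0 (z : R[i]) : 0 <= sqmod z.
Proof. exact: sqr_ge0. Qed.

(** One positive summand suffices: l = N gives the argument K + (p+1)/2. *)
Lemma QM_gt0 p K N j : (0 < p)%N -> (0 < K)%N -> (0 < N)%N -> (0 < j <= K)%N ->
  0 < QM p K N (j%:R / K%:R : R).
Proof.
move=> p0 K0 N0 /andP[j0 jK]; rewrite /QM mulr_gt0 ?invr_gt0 ?ltr0n // big_nat_recr //=.
rewrite ltr_wpDl ?sumr_ge0 // => [l _|]; first exact: sqmod_ge0.
rewrite /sqmod exprn_gt0 // lt_def; apply/andP; split; last first.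
  by case: (Phi _ _ _) => a b; exact: sqrtr_ge0.
have -> : N%:R / (N%:R / K%:R) = K%:R :> R.
  by rewrite invf_div mulrCA divff ?mulr1 // pnatr_eq0 -lt0n.
have u01 : 0 < (j%:R / K%:R : R) <= 1.
  by rewrite divr_gt0 ?ltr0n //= ler_pdivrMr ?ltr0n // mul1r ler_nat.
apply: contra (Phi_center_neq0 K p0 u01) => /eqP /Normc.eq0_normc.
by rewrite /zexp => ->.
Qed.

End QFunctions.

(** * Integrals of piecewise polynomials and orthogonality *)

Section PiecewiseIntegration.
Variable R : realType.
Local Notation mu := (@lebesgue_measure R).
Implicit Types (f : R -> R) (a b : R).

Lemma continuous_poly (P : {poly R}) : continuous (horner P).
Proof.
move=> x; apply: differentiable_continuous.
by apply/derivable1_diffP; have [] := is_derive_poly P x.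
Qed.

Lemma integral_poly (P : {poly R}) a b : a < b ->
  (\int[mu]_(x in `[a, b]) (P.[x])%:E = (pint P a b)%:E)%E.
Proof.
move=> ab; rewrite (@continuous_FTC2 _ _ (horner (pprim P))) //.
- exact/continuous_subspaceT/continuous_poly.
- split=> [x _||].
  + by have [] := is_derive_poly (pprim P) x.
  + exact/cvg_at_right_filter/continuous_poly.
  + exact/cvg_at_left_filter/continuous_poly.
- move=> x _; rewrite derive1E (@derive_val _ _ _ _ _ _ _ (is_derive_poly (pprim P) x)).
  by rewrite deriv_pprim.
Qed.

Lemma measurable_eq_poly f (P : {poly R}) a b :
  (forall x, a < x < b -> f x = P.[x]) -> measurable_fun `]a, b[ f.
Proof.
move=> fP; apply: (eq_measurable_fun (horner P)) => [x|].
  by rewrite inE /= in_itv /= => /fP.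
apply: measurable_funTS; apply: continuous_measurable_fun.
exact: continuous_poly.
Qed.

Lemma integral_eq_poly f (P : {poly R}) a b (b0 b1 : bool) : a <= b ->
  (forall x, a < x < b -> f x = P.[x]) ->
  (\int[mu]_(x in [set` Interval (BSide b0 a) (BSide b1 b)]) (f x)%:E =
   (pint P a b)%:E)%E.
Proof.
move=> ab fP; have mf := measurable_eq_poly fP.
have mP : measurable_fun `]a, b[ (horner P) by exact: measurable_eq_poly.
rewrite (@eq_integral_itv_bounded _ _ _ (horner P)) //.
rewrite integral_itv_bndoo; last exact/measurable_EFinP.
move: ab; rewrite le_eqVlt => /orP[/eqP ->|ab].
  by rewrite set_itvoo0 integral_set0 /pint subrr.
by rewrite -(integral_itv_bndoo true false) ?integral_poly //; exact/measurable_EFinP.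
Qed.

(** Agreement is asked on open cells only: at the breakpoints, derivatives of the exponential
    splines need not follow any of the polynomials. *)
Lemma integral_piecewise f (P : nat -> {poly R}) (r : nat -> R) n :
  (forall i, (i < n)%N -> r i <= r i.+1) ->
  (forall i x, (i < n)%N -> r i < x < r i.+1 -> f x = (P i).[x]) ->
  [/\ r 0%N <= r n, measurable_fun `[r 0%N, r n] f &
  (\int[mu]_(x in `[r 0%N, r n]) (f x)%:E =
   (\sum_(0 <= i < n) pint (P i) (r i) (r i.+1))%:E)%E].
Proof.
elim: n => [|n IHn] rr fP.
  by rewrite big_geq // set_itv1 integral_set1; split=> //; exact: measurable_fun_set1.
have [r0n mn In] := IHn (fun i h => rr i (ltnW h)) (fun i x h => fP i x (ltnW h)).
have rn := rr n (ltnSn n); have fn x := fP n x (ltnSn n).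
have U : `[r 0%N, r n.+1]%classic = `[r 0%N, r n] `|` `]r n, r n.+1].
  by rewrite -itv_bndbnd_setU // bnd_simp.
have mp : measurable_fun `]r n, r n.+1] f.
  exact: measurable_fun_itv_oc (measurable_eq_poly fn).
have mU : measurable_fun (`[r 0%N, r n] `|` `]r n, r n.+1]) f.
  by apply/measurable_funU.
split; [exact: le_trans rn|by rewrite U|].
rewrite U integral_setU //.
- by rewrite In (integral_eq_poly _ _ rn fn) big_nat_recr.
- exact/measurable_EFinP.
- apply/disj_setPS => x [] /=; rewrite !in_itv /= => /andP[_ h] /andP[h' _].
  by have := lt_le_trans h' h; rewrite ltxx.
Qed.

End PiecewiseIntegration.

Section ComplexPiecewise.
Variable R : realType.
Implicit Types (P : {poly R[i]}) (x : R).
Local Notation Re := complex.Re.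
Local Notation Im := complex.Im.

Lemma Re_sum (I : Type) (r : seq I) (F : I -> R[i]) :
  Re (\sum_(i <- r) F i) = \sum_(i <- r) Re (F i).
Proof. by apply: (big_morph _ (@Re_add R)). Qed.

Lemma Im_sum (I : Type) (r : seq I) (F : I -> R[i]) :
  Im (\sum_(i <- r) F i) = \sum_(i <- r) Im (F i).
Proof. by apply: (big_morph _ (@Im_add R)). Qed.

Lemma Re_muln (c : R[i]) n : Re (c *+ n) = Re c *+ n.
Proof. by elim: n => [|n IHn] //; rewrite !mulrSr Re_add IHn. Qed.

Lemma Im_muln (c : R[i]) n : Im (c *+ n) = Im c *+ n.
Proof. by elim: n => [|n IHn] //; rewrite !mulrSr Im_add IHn. Qed.

Definition Repoly P : {poly R} := map_poly (@complex.Re R) P.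
Definition Impoly P : {poly R} := map_poly (@complex.Im R) P.

Lemma horner_Repoly P x : (Repoly P).[x] = Re P.[x%:C].
Proof.
rewrite (horner_coef_wide x (size_poly _ _)) horner_coef Re_sum.
apply: eq_bigr => i _; rewrite coef_map_id0 // -rmorphXn Re_mul /=.
by rewrite mulr0 subr0.
Qed.

Lemma horner_Impoly P x : (Impoly P).[x] = Im P.[x%:C].
Proof.
rewrite (horner_coef_wide x (size_poly _ _)) horner_coef Im_sum.
apply: eq_bigr => i _; rewrite coef_map_id0 // -rmorphXn Im_mul /=.
by rewrite mulr0 add0r.
Qed.

Lemma deriv_Repoly P : (Repoly P)^`() = Repoly P^`().
Proof.
by apply/polyP => i; rewrite coef_deriv !coef_map_id0 // coef_deriv Re_muln.
Qed.

Lemma deriv_Impoly P : (Impoly P)^`() = Impoly P^`().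
Proof.
by apply/polyP => i; rewrite coef_deriv !coef_map_id0 // coef_deriv Im_muln.
Qed.

Lemma pint_Repoly P (a b : R) : pint (Repoly P) a b = Re (pint P a%:C b%:C).
Proof.
rewrite -{1}(deriv_pprim P) -deriv_Repoly pint_deriv !horner_Repoly /pint.
by case: (_.[_]) => ? ?; case: (_.[_]).
Qed.

Lemma pint_Impoly P (a b : R) : pint (Impoly P) a b = Im (pint P a%:C b%:C).
Proof.
rewrite -{1}(deriv_pprim P) -deriv_Impoly pint_deriv !horner_Impoly /pint.
by case: (_.[_]) => ? ?; case: (_.[_]).
Qed.

Lemma cintegral01_piecewise (f : R -> R[i]) (P : nat -> {poly R[i]}) (r : nat -> R) n :
  r 0%N = 0 -> r n = 1 ->
  (forall i, (i < n)%N -> r i <= r i.+1) ->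
  (forall i x, (i < n)%N -> r i < x < r i.+1 -> f x = (P i).[x%:C]) ->
  cintegral01 f = \sum_(0 <= i < n) pint (P i) (r i)%:C (r i.+1)%:C.
Proof.
move=> r0 rn rr fP; apply/eqP; rewrite eq_complex /cintegral01 /= /Rintegral.
rewrite -{1 2}r0 -{1 2}rn Re_sum Im_sum.
have [_ _ ->] := @integral_piecewise R (fun x => Re (f x)) (Repoly \o P) r n rr
  (fun i x hi hx => etrans (congr1 (@complex.Re R) (fP i x hi hx)) (esym (horner_Repoly _ _))).
have [_ _ ->] := @integral_piecewise R (fun x => Im (f x)) (Impoly \o P) r n rr
  (fun i x hi hx => etrans (congr1 (@complex.Im R) (fP i x hi hx)) (esym (horner_Impoly _ _))).
apply/andP; split; apply/eqP; apply: eq_bigr => i _.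
  exact: pint_Repoly.
exact: pint_Impoly.
Qed.

Lemma is_cderive_poly P x : is_cderive (fun y => P.[y%:C]) x P^`().[x%:C].
Proof.
have dx : is_cderive (fun y : R => y%:C) x 1.
  by apply: is_cderive_real; exact: is_derive_id.
by have := is_cderive_horner P dx; rewrite mulr1.
Qed.

Lemma cderive_poly n P (f : R -> R[i]) (a b x : R) :
  (forall y, a < y < b -> f y = P.[y%:C]) -> a < x < b ->
  cderive n f x = P^`(n).[x%:C].
Proof.
move=> fP ab; apply: (@cderiveE R (fun n y => P^`(n).[y%:C]) `]a, b[%classic).
- exact: itv_open.
- by move=> m y _; rewrite derivnS; exact: is_cderive_poly.
- by move=> y; rewrite inE /= in_itv /= => /fP.
- by rewrite /= in_itv.
Qed.

End ComplexPiecewise.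

(** * Gram matrices of the exponential splines *)

Section Gram.
Variable R : realType.
Implicit Types (u x : R) (m n p q K i j : nat).

Lemma sum_unity (F : fieldType) (c : F) K : c ^+ K = 1 -> c != 1 ->
  \sum_(0 <= k < K) c ^+ k = 0.
Proof.
move=> cK c1; apply: (mulfI (_ : c - 1 != 0)); first by rewrite subr_eq0.
by rewrite mulr0 big_mkord -subrX1 cK subrr.
Qed.

Lemma zexpX_K K j : (0 < K)%N -> zexp (j%:R / K%:R : R) ^+ K = 1.
Proof.
move=> K0; rewrite /zexp expiX (_ : _ * _ = - (j%:R * (2 * pi))).
  by rewrite expiN expi_natmul_2pi invr1.
by field; rewrite pnatr_eq0 -lt0n.
Qed.

Lemma zexp_inj K i j : (0 < i <= K)%N -> (0 < j <= K)%N ->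
  zexp (i%:R / K%:R : R) = zexp (j%:R / K%:R) -> i = j.
Proof.
wlog ij : i j / (i <= j)%N => [hw|].
  by case/orP: (leq_total i j) => h iK jK e; [|apply/esym]; apply: hw.
move=> /andP[i0 iK] /andP[j0 jK] e; apply/eqP; move: ij; rewrite leq_eqVlt => /orP[//|ij].
have K0 : (0 : R) < K%:R by rewrite ltr0n (leq_trans j0).
have : zexp ((j - i)%:R / K%:R : R) != 1.
  apply: expi_neq1; apply/andP; split; first by rewrite divr_gt0 ?K0 // ltr0n subn_gt0.
  by rewrite ltr_pdivrMr // mul1r ltr_nat (leq_trans _ jK) // ltn_subrL i0.
suff -> : zexp ((j - i)%:R / K%:R : R) = 1 by rewrite eqxx.
apply: (mulIf (zexp_neq0 (i%:R / K%:R))); rewrite mul1r [RHS]e /zexp -expiD.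
by congr expi; rewrite natrB ?(ltnW ij) //; ring.
Qed.

Lemma ratio01 K j : (0 < j <= K)%N -> 0 < (j%:R / K%:R : R) <= 1.
Proof.
move=> /andP[j0 jK]; have K0 : (0 : R) < K%:R by rewrite ltr0n (leq_trans j0).
by apply/andP; split; [rewrite divr_gt0 ?K0 // ltr0n | rewrite ler_pdivrMr // mul1r ler_nat].
Qed.

(* Both [odd p] and [~~ odd p] put the breakpoints of
   [x |-> Phi p (K x + (p+1)/2) z] among the points [i / 2K]. *)
Definition halfpt K (i : nat) : R := i%:R / (2 * K%:R).

Lemma horner_halfarg K (a : R) x :
  ((K%:R : R[i]) *: 'X + (a%:C)%:P).[x%:C] = (K%:R * x + a)%:C.
Proof.
by rewrite hornerD hornerZ hornerX hornerC rmorphD rmorphM /= (rmorph_nat (@real_complex R)).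
Qed.

(** According to the parity of i + p + 1, cell i of the half grid is the left or the right half of
    the polynomial piece number (i+p+1)/2, rounded down. *)
Lemma halfptE K p i : (0 < K)%N ->
  K%:R * halfpt K i + (p.+1%:R / 2 - (i + p.+1)./2%:R) = (odd (i + p.+1))%:R / 2.
Proof.
move=> K0; have K1 : (K%:R : R) != 0 by rewrite pnatr_eq0 -lt0n.
have := congr1 (fun n => n%:R : R) (odd_double_half (i + p.+1)).
rewrite natrD -mul2n natrM (natrD _ i) => e.
rewrite /halfpt; have -> : p.+1%:R = (odd (i + p.+1))%:R + 2 * ((i + p.+1)./2)%:R - i%:R :> R.
  by rewrite e addrC addKr.
by field.
Qed.

Lemma Phi_half m K p u i x : 0 < u <= 1 -> (0 < K)%N ->
  halfpt K i < x < halfpt K i.+1 ->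
  Phi m (K%:R * x + p.+1%:R / 2) (zexp u) =
  (zexp u ^+ (i + p.+1)./2 *: (efpoly m (zexp u) \Po
    (K%:R *: 'X + ((p.+1%:R / 2 - (i + p.+1)./2%:R : R)%:C)%:P))).[x%:C].
Proof.
move=> u01 K0 /andP[x1 x2]; have K1 : (0 : R) < K%:R by rewrite ltr0n.
rewrite hornerZ horner_comp horner_halfarg.
have h1 := halfptE p i K0; set n := (i + p.+1)./2 in h1 *.
have xK : K%:R * halfpt K i.+1 = K%:R * halfpt K i + 2^-1.
  by rewrite /halfpt -natr1; field; rewrite gt_eqF.
have y1 : K%:R * halfpt K i < K%:R * x by rewrite ltr_pM2l.
have y2 : K%:R * x < K%:R * halfpt K i.+1 by rewrite ltr_pM2l.
have o1 : (0 : R) <= (odd (i + p.+1))%:R by [].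
have o2 : (odd (i + p.+1))%:R <= 1 :> R by case: (odd _).
have -> : K%:R * x + p.+1%:R / 2 = n%:R + (K%:R * x + (p.+1%:R / 2 - n%:R)) by ring.
apply: PhiE; [exact: zexp_neq0|exact: zexp1_or_off|apply/andP; split; lra].
Qed.

Lemma derivn_efpoly_comp p q z (a b : R[i]) : (q <= p)%N ->
  (efpoly p z \Po (a *: 'X + b%:P))^`(q) =
  ((a * (1 - z^-1)) ^+ q) *: (efpoly (p - q) z \Po (a *: 'X + b%:P)).
Proof.
elim: q => [|q IHq] qp; first by rewrite derivn0 expr0 scale1r subn0.
rewrite derivnS IHq; last exact: ltnW.
have -> : (p - q = (p - q.+1).+1)%N by rewrite subnSK.
rewrite derivZ deriv_comp deriv_efpoly derivD derivZ derivX derivC addr0.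
rewrite mulr_algr comp_polyZ !scalerA; congr (_ *: _).
by rewrite exprSr; ring.
Qed.

Lemma cderive_Phi p q K u (c : R[i]) (f : R -> R[i]) i x :
  0 < u <= 1 -> (0 < K)%N -> (q <= p)%N ->
  (forall y, f y = c * Phi p (K%:R * y + p.+1%:R / 2) (zexp u)) ->
  halfpt K i < x < halfpt K i.+1 ->
  cderive q f x =
  c * (K%:R * (1 - (zexp u)^-1)) ^+ q *
    Phi (p - q) (K%:R * x + p.+1%:R / 2) (zexp u).
Proof.
move=> u01 K0 qp fE xi.
pose E := efpoly p (zexp u) \Po
    (K%:R *: 'X + ((p.+1%:R / 2 - (i + p.+1)./2%:R : R)%:C)%:P).
rewrite (@cderive_poly R q ((c * zexp u ^+ (i + p.+1)./2) *: E) f _ _ x _ xi).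
  rewrite derivnZ derivn_efpoly_comp // (Phi_half _ _ u01 K0 xi) !hornerZ; ring.
by move=> y yi; rewrite fE (Phi_half _ _ u01 K0 yi) !hornerZ mulrA.
Qed.

(** A sum over a full period may start anywhere. This removes the offset p + 1, and with it the
    parity of p. *)
Lemma sum_half_periodic (V : zmodType) (g : nat -> V) K n :
  (forall i, g (i + 2 * K)%N = g i) ->
  \sum_(0 <= i < 2 * K) g (i + n)%N = \sum_(0 <= i < 2 * K) g i.
Proof.
move=> gK; elim: n => [|n IHn]; first by under eq_bigr do rewrite addn0.
rewrite -IHn; apply/eqP; rewrite -subr_eq0 -sumrB.
under eq_bigr do rewrite addnS -addSn.
by rewrite (telescope_sumr (fun i => g (i + n)%N)) // add0n addnC gK subrr.
Qed.

Lemma sum_double (V : zmodType) (g : nat -> V) K :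
  \sum_(0 <= i < 2 * K) g i = \sum_(0 <= k < K) (g (2 * k)%N + g (2 * k).+1).
Proof.
elim: K => [|K IHK]; first by rewrite muln0 !big_geq.
by rewrite mulnS !big_nat_recr //= IHK addrA.
Qed.

Lemma pconj_comp (E : {poly R[i]}) K (a : R) :
  pconj (E \Po (K%:R *: 'X + (a%:C)%:P)) = pconj E \Po (K%:R *: 'X + (a%:C)%:P).
Proof.
rewrite /pconj map_comp_poly rmorphD /= map_polyZ map_polyX map_polyC /= rmorph_nat.
by rewrite (CrealP _) // complex_real.
Qed.

(** With c = z / w, the product on piece number n is c^n times one fixed polynomial. Its integral
    over [0, 1] factors out of the geometric sum of the c^k, which is 0 unless c = 1, that is i =
    j. *)
Lemma gram_Phi m p K i j (al be : R[i]) (f g : R -> R[i]) :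
  (0 < i <= K)%N -> (0 < j <= K)%N ->
  (forall k x, halfpt K k < x < halfpt K k.+1 ->
     f x = al * Phi m (K%:R * x + p.+1%:R / 2) (zexp (i%:R / K%:R))) ->
  (forall k x, halfpt K k < x < halfpt K k.+1 ->
     g x = be * Phi m (K%:R * x + p.+1%:R / 2) (zexp (j%:R / K%:R))) ->
  cintegral01 (fun x => f x * (g x)^*) =
  al * be^* * (Q (2 * m) (i%:R / K%:R))%:C * (i == j)%:R.
Proof.
move=> iK jK fE gE; have ui := ratio01 iK; have uj := ratio01 jK.
have K0 : (0 < K)%N by case/andP: iK => i0; exact: leq_trans.
have K1 : (K%:R : R) != 0 by rewrite pnatr_eq0 -lt0n.
have K1' : (K%:R : R[i]) != 0 by rewrite pnatr_eq0 -lt0n.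
set z := zexp (i%:R / K%:R) in fE *; set w := zexp (j%:R / K%:R) in gE *.
pose E := efpoly m z * pconj (efpoly m w).
pose L k := (K%:R : R[i]) *: 'X + ((p.+1%:R / 2 - (k + p.+1)./2%:R : R)%:C)%:P.
pose c := z / w.
pose P k := (al * be^* * c ^+ (k + p.+1)./2) *: (E \Po L k).
have Pf k x : halfpt K k < x < halfpt K k.+1 -> f x * (g x)^* = (P k).[x%:C].
  move=> xk; rewrite (fE k) // (gE k) // (Phi_half _ _ ui K0 xk) (Phi_half _ _ uj K0 xk).
  rewrite -/z -/w -/(L k) !hornerZ !rmorphM /= -horner_pconj pconj_comp -/(L k) !horner_comp hornerM.
  rewrite rmorphXn /= conj_zexp -/w exprVn /c expr_div_n !horner_comp.
  ring.
rewrite (@cintegral01_piecewise R _ P (halfpt K) (2 * K)) //; first last.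
- by move=> k x _; exact: Pf.
- move=> k _; rewrite /halfpt ler_pM2r ?ler_nat // invr_gt0 mulr_gt0 //.
  by rewrite ltr0n.
- by rewrite /halfpt natrM divff // mulf_neq0.
- by rewrite /halfpt mul0r.
(* The integral over one half of a piece; consecutive even and odd k join to the interval [0, 1]. *)
pose G k := c ^+ k./2 * pint E ((odd k)%:R / 2) (((odd k)%:R + 1) / 2).
have PG k : pint (P k) (halfpt K k)%:C (halfpt K k.+1)%:C =
    al * be^* / K%:R * G (k + p.+1)%N.
  rewrite /P pintZ pint_comp // /G.
  have e1 : K%:R * (halfpt K k)%:C + (p.+1%:R / 2 - (k + p.+1)./2%:R : R)%:C =
      (odd (k + p.+1))%:R / 2 :> R[i].
    rewrite -(rmorph_nat (@real_complex R)) -rmorphM -rmorphD /= halfptE //.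
    by rewrite rmorphM fmorphV /= !(rmorph_nat (@real_complex R)).
  have e2 : K%:R * (halfpt K k.+1)%:C + (p.+1%:R / 2 - (k + p.+1)./2%:R : R)%:C =
      ((odd (k + p.+1))%:R + 1) / 2 :> R[i].
    rewrite mulrDl mul1r -e1 addrAC; congr (_ + _).
    have -> : halfpt K k.+1 = halfpt K k + (2 * K%:R)^-1.
      by rewrite /halfpt -natr1 mulrDl mul1r.
    rewrite rmorphD mulrDr; congr (_ + _).
    by rewrite fmorphV rmorphM /= !(rmorph_nat (@real_complex R)); field.
  by rewrite e1 e2; ring.
under eq_bigr do rewrite PG.
have cK : c ^+ K = 1 by rewrite exprMn exprVn !zexpX_K // invr1 mulr1.
rewrite -big_distrr /= sum_half_periodic; last first.
  move=> k; rewrite /G oddD oddM addbF -{1}(odd_double_half k) -addnA mul2n -doubleD.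
  by rewrite half_bit_double exprD cK mulr1.
rewrite sum_double; under eq_bigr => k _.
  rewrite /G mul2n doubleK /= uphalf_double odd_double /= -mulrDr mul0r add0r.
  rewrite div1r (_ : (1 + 1) / 2 = 1 :> R[i]); last by rewrite divff // pnatr_eq0.
  rewrite pint_split; over.
rewrite -big_distrl /=.
have [ij|ij] := eqVneq i j.
  have cE : c = 1 by rewrite /c /z ij divff ?zexp_neq0.
  under eq_bigr do rewrite cE expr1n.
  rewrite sumr_const_nat subn0 /E /w -ij -/z pint_efpoly_Q // mulr1.
  by field.
rewrite sum_unity ?mul0r ?mulr0 //.
apply: contra ij => /eqP c1; apply/eqP/(zexp_inj iK jK).
by rewrite -/z -/w -[z](divfK (zexp_neq0 (j%:R / K%:R))) -/w -/c c1 mul1r.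
Qed.

End Gram.

(** * Continuous and discrete orthonormality *)

Section Orthonormality.
Variable R : realType.
Implicit Types (u x : R) (m n p q K N i j : nat).

Lemma mul_conj_sqmod (z : R[i]) : z * z^* = (sqmod z)%:C.
Proof.
case: z => a b; rewrite /sqmod /Normc.normc sqr_sqrtr ?addr_ge0 ?sqr_ge0 //.
by apply/eqP; rewrite eq_complex /= !expr2; apply/andP; split; apply/eqP; ring.
Qed.

Lemma conj_realC x : (x%:C)^* = x%:C :> R[i].
Proof. by apply/CrealP; rewrite complex_real. Qed.

Lemma zexp_sin2_conj u : (1 - (zexp u)^-1) * (1 - zexp u) = ((2 * sin (pi * u)) ^+ 2)%:C.
Proof.
have z0 := zexp_neq0 u.
transitivity (- (zexp u - 1) ^+ 2 / zexp u); first by field.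
rewrite zexp_sin2 rmorphXn rmorphM /= (rmorph_nat (@real_complex R) 2).
by move: (sin _)%:C => w; field.
Qed.

(** Covers [psi] and [phi], which differ only in the normalization [D]. *)
Definition scaled_Phi p K (D : nat -> R) j x : R[i] :=
  Phi p (K%:R * x + p.+1%:R / 2) (zexp (j%:R / K%:R)) / (Num.sqrt (D j))%:C.

Lemma invsqrt_sqr (D : R) : 0 < D ->
  (Num.sqrt D)%:C^-1 * ((Num.sqrt D)%:C^-1)^* = (D^-1)%:C :> R[i].
Proof.
move=> D0; have -> : ((Num.sqrt D)%:C^-1)^* = (Num.sqrt D)%:C^-1 :> R[i].
  by rewrite -fmorphV conj_realC.
by rewrite -fmorphV -rmorphM /= -invfM -expr2 sqr_sqrtr ?ltW.
Qed.

Lemma mul_conj_scaled (a : R[i]) (D : R) : 0 < D ->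
  a / (Num.sqrt D)%:C * (a / (Num.sqrt D)%:C)^* = (sqmod a)%:C * (D^-1)%:C.
Proof. by move=> D0; rewrite rmorphM mulrACA mul_conj_sqmod invsqrt_sqr. Qed.

(** Each derivative contributes the factor K (1 - 1/z), of squared modulus (2 K sin (pi i / K))^2 =
    (2 pi i sinc (pi i / K))^2, where i is the index. *)
Lemma gram_scaled_Phi p q K (D : nat -> R) i j :
  (q <= p)%N -> (0 < i <= K)%N -> (0 < j <= K)%N -> 0 < D i ->
  cintegral01 (fun x => cderive q (scaled_Phi p K D i) x *
    (cderive q (scaled_Phi p K D j) x)^*) =
  ((2 * pi * i%:R) ^+ (2 * q) * sinc (pi * i%:R / K%:R) ^+ (2 * q) *
    (Q (2 * p - 2 * q) (i%:R / K%:R) / D i))%:C * (i == j)%:R.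
Proof.
move=> qp iK jK Di; have ui := ratio01 R iK; have uj := ratio01 R jK.
have K0 : (0 < K)%N by case/andP: iK => i0; exact: leq_trans.
have K1 : (K%:R : R) != 0 by rewrite pnatr_eq0 -lt0n.
have i1 : (i%:R : R) != 0 by rewrite pnatr_eq0 -lt0n; case/andP: iK.
have pi0 : (pi : R) != 0 by rewrite gt_eqF ?pi_gt0.
pose be k := (Num.sqrt (D k))%:C^-1 * (K%:R * (1 - (zexp (k%:R / K%:R : R))^-1)) ^+ q.
have E k : (0 < k <= K)%N -> forall l x, halfpt R K l < x < halfpt R K l.+1 ->
    cderive q (scaled_Phi p K D k) x =
    be k * Phi (p - q) (K%:R * x + p.+1%:R / 2) (zexp (k%:R / K%:R)).
  move=> kK l x xl; apply: (cderive_Phi _ K0 qp _ xl); first exact: ratio01.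
  by move=> y; rewrite /scaled_Phi mulrC.
rewrite (gram_Phi iK jK (E i iK) (E j jK)).
have [<-|ij] := eqVneq i j; last by rewrite !mulr0.
rewrite !mulr1 mulnBr; set Qv := Q _ _.
have bb : be i * (be i)^* =
    ((D i)^-1)%:C * ((K%:R * (2 * sin (pi * (i%:R / K%:R)))) ^+ (2 * q))%:C.
  rewrite /be rmorphM mulrACA invsqrt_sqr //; congr (_ * _).
  rewrite rmorphXn -exprMn rmorphM rmorphB rmorph1 fmorphV /= conj_zexp invrK rmorph_nat.
  rewrite exprM [RHS]rmorphXn; apply: (congr1 (fun w => w ^+ q)).
  rewrite mulrACA zexp_sin2_conj -expr2 [in RHS]exprMn [RHS]rmorphM; congr (_ * _).
  by rewrite rmorphXn /= rmorph_nat.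
rewrite bb -!rmorphM; congr (_%:C).
have -> : sinc (pi * i%:R / K%:R) = sin (pi * (i%:R / K%:R)) / (pi * i%:R / K%:R) :> R.
  by rewrite /sinc !mulf_eq0 invr_eq0 (negbTE pi0) (negbTE i1) (negbTE K1) /= mulrA.
rewrite -exprMn.
have -> : 2 * pi * i%:R * (sin (pi * (i%:R / K%:R)) / (pi * i%:R / K%:R)) =
    K%:R * (2 * sin (pi * (i%:R / K%:R))) :> R.
  move: (sin _) => s; move: (pi : R) pi0 (i%:R : R) i1 => x x0 y y0.
  by field; rewrite ?x0 ?y0 ?K1.
by ring.
Qed.

Lemma gram0_scaled_Phi p K (D : nat -> R) i j :
  (0 < i <= K)%N -> (0 < j <= K)%N -> 0 < D i ->
  cintegral01 (fun x => scaled_Phi p K D i x * (scaled_Phi p K D j x)^*) =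
  (Q (2 * p) (i%:R / K%:R) / D i)%:C * (i == j)%:R.
Proof.
move=> iK jK Di.
have E k l x : halfpt R K l < x < halfpt R K l.+1 -> scaled_Phi p K D k x =
    (Num.sqrt (D k))%:C^-1 * Phi p (K%:R * x + p.+1%:R / 2) (zexp (k%:R / K%:R)).
  by move=> _; rewrite /scaled_Phi mulrC.
rewrite (gram_Phi iK jK (E i) (E j)).
have [<-|ij] := eqVneq i j; last by rewrite !mulr0.
by rewrite invsqrt_sqr // -rmorphM /= mulrC [RHS]mulr1 mul1r mulrC.
Qed.

Lemma PhiS p (t : R) (z : R[i]) : z != 0 -> Phi p (t + 1) z = z * Phi p t z.
Proof.
move=> z0; rewrite /Phi; case: eqP => [->|_]; first by rewrite mulr1.
have -> : Num.floor (t + 1) = (Num.floor t + 1)%R.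
  apply: floor_def; have := floor_itv t; rewrite !intrD => /andP[a b].
  by rewrite lerD2r a ltrD2r.
have -> : fracpart (t + 1) = fracpart t.
  rewrite /fracpart; have -> : Num.floor (t + 1) = (Num.floor t + 1)%R.
    apply: floor_def; have := floor_itv t; rewrite !intrD => /andP[a b].
    by rewrite lerD2r a ltrD2r.
  by rewrite intrD opprD addrACA subrr addr0.
by rewrite expfzDr // expr1z [_ * z]mulrC -!mulrA.
Qed.

Lemma sum_blocks (V : zmodType) (g : nat -> V) K M :
  \sum_(0 <= l < K * M) g l = \sum_(0 <= k < K) \sum_(0 <= r < M) g (r + k * M)%N.
Proof.
elim: K => [|K IHK]; first by rewrite mul0n !big_geq.
rewrite big_nat_recr //= -IHK (@big_cat_nat _ _ _ (K * M)%N) ?leq_mul2r ?leqnSn ?orbT //=.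
congr (_ + _); rewrite -{1}[(K * M)%N]add0n big_addn mulSn addnK.
by [].
Qed.

(** For i = j the sum is the definition of [QM]. Otherwise, with M = N / K an integer, moving l by M
    moves the argument of Phi by 1 and multiplies the summand by c = z / w; the K blocks of length M
    then form a vanishing geometric sum. *)
Lemma discrete_gram p K N i j :
  (0 < p)%N -> (0 < K)%N -> (0 < N)%N -> (0 < i <= K)%N -> (0 < j <= K)%N ->
  i = j \/ (K %| N)%N ->
  N%:R^-1 * \sum_(1 <= l < N.+1)
    scaled_Phi p K (fun k => QM p K N (k%:R / K%:R)) i (l%:R / N%:R : R) *
    (scaled_Phi p K (fun k => QM p K N (k%:R / K%:R)) j (l%:R / N%:R))^*
  = (i == j)%:R.
Proof.
move=> p0 K0 N0 iK jK ij.
have K1 : (K%:R : R) != 0 by rewrite pnatr_eq0 -lt0n.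
have N1 : (N%:R : R) != 0 by rewrite pnatr_eq0 -lt0n.
have N1' : (N%:R : R[i]) != 0 by rewrite pnatr_eq0 -lt0n.
have Qi := QM_gt0 R p0 K0 N0 iK.
have [e|/eqP ne] := eqVneq i j.
  have QE : N%:R^-1 * \sum_(1 <= l < N.+1) sqmod (Phi p (l%:R / (N%:R / K%:R) + p.+1%:R / 2)
    (zexp (i%:R / K%:R : R))) = QM p K N (i%:R / K%:R) by [].
  rewrite -e; transitivity (N%:R^-1 * \sum_(1 <= l < N.+1)
    (sqmod (Phi p (l%:R / (N%:R / K%:R) + p.+1%:R / 2) (zexp (i%:R / K%:R : R))))%:C *
      ((QM p K N (i%:R / K%:R : R))^-1)%:C).
    congr (_ * _); apply: eq_bigr => l _.
    have -> : l%:R / (N%:R / K%:R) = K%:R * (l%:R / N%:R) :> R by field; rewrite N1 K1.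
    exact: mul_conj_scaled.
  rewrite -big_distrl /= -rmorph_sum -(rmorph_nat (@real_complex R)) -fmorphV mulrA -rmorphM.
  by rewrite QE -rmorphM /= divff // gt_eqF.
case: ij => [//|/dvdnP[M NE]].
have M0 : (0 < M)%N by move: N0; rewrite NE muln_gt0 => /andP[].
have M1 : (M%:R : R) != 0 by rewrite pnatr_eq0 -lt0n.
pose D k : R := QM p K N (k%:R / K%:R).
pose g l : R[i] := scaled_Phi p K D i (l.+1%:R / N%:R) * (scaled_Phi p K D j (l.+1%:R / N%:R))^*.
suff g0 : \sum_(0 <= l < N) g l = 0 by rewrite big_add1 g0 mulr0.
pose c := zexp (i%:R / K%:R : R) / zexp (j%:R / K%:R).
have gM l : g (l + M)%N = c * g l.
  rewrite /g /scaled_Phi.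
  have -> : K%:R * ((l + M).+1%:R / N%:R) + p.+1%:R / 2 =
      K%:R * (l.+1%:R / N%:R) + p.+1%:R / 2 + 1 :> R.
    by rewrite -addSn natrD NE natrM; field; rewrite M1 K1.
  rewrite !PhiS ?zexp_neq0 // !rmorphM /= conj_zexp /c; ring.
have gk l k : g (l + k * M)%N = c ^+ k * g l.
  by elim: k => [|k IHk]; rewrite ?mul1r ?addn0 // mulSnr addnA gM IHk exprS mulrA.
rewrite [X in \sum_(_ <= _ < X) _]NE mulnC sum_blocks.
under eq_bigr do (under eq_bigr do rewrite gk; rewrite -big_distrr /=).
rewrite -big_distrl /= sum_unity ?mul0r //.
- by rewrite exprMn exprVn !zexpX_K // invr1 mulr1.
- apply/eqP => c1; apply: ne; apply: (zexp_inj iK jK (R := R)).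
  by rewrite -[LHS](divfK (zexp_neq0 (j%:R / K%:R))) -/c c1 mul1r.
Qed.

End Orthonormality.

(** * Periodic splines *)

Section PolynomialFacts.
Variable F : numFieldType.
Implicit Types (P T : {poly F}) (a b : F).

Lemma poly_eq0_of_derivn n T a : (size T <= n)%N ->
  (forall k, (k < n)%N -> T^`(k).[a] = 0) -> T = 0.
Proof.
elim: n T => [|n IHn] T sT T0; first by apply/eqP; rewrite -size_poly_leq0.
have T'0 : T^`() = 0.
  apply: IHn => [|k kn]; last by rewrite -derivSn T0.
  by apply/leq_sizeP => j nj; rewrite coef_deriv nth_default ?mul0rn //; exact: leq_trans sT _.
have := T0 0%N isT; rewrite derivn0 (deriv_eq0_polyC T'0) hornerC => ->.
by rewrite polyC0.
Qed.

(** By induction the derivative is a constant, which equals T(1) - T(0) = 0. *)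
Lemma polyC_of_derivn_periodic n T : (size T <= n)%N ->
  (forall k, (k < n)%N -> T^`(k).[0] = T^`(k).[1]) -> exists c, T = c%:P.
Proof.
elim: n T => [|n IHn] T sT TP.
  by exists 0; rewrite polyC0; apply/eqP; rewrite -size_poly_leq0.
have [|k kn|c cT] := IHn T^`(); first 1 last.
- by rewrite -!derivSn TP.
- exists T`_0; apply: deriv_eq0_polyC; rewrite cT.
  have := pint_deriv T 0 1; rewrite -[T in T.[1]]derivn0 -[T in _ - T.[0]]derivn0 TP // subrr cT.
  by rewrite -[c%:P]mulr1 mul_polyC -(derivX _) pintZ pint_deriv !hornerX subr0 mulr1 => ->; rewrite scale0r.
- by apply/leq_sizeP => j nj; rewrite coef_deriv nth_default ?mul0rn //; exact: leq_trans sT _.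
Qed.

Lemma horner_derivn_pred n P a b : (size P <= n.+2)%N ->
  P^`(n).[b] - P^`(n).[a] = n.+1`!%:R * P`_n.+1 * (b - a).
Proof.
move=> sP; have sQ : (size P^`(n) <= 2)%N.
  apply/leq_sizeP => j j2; rewrite coef_derivn nth_default ?mul0rn //.
  by apply: leq_trans sP _; rewrite -addn2 leq_add2l.
rewrite !(horner_coef_wide _ sQ) !big_ord_recl !big_ord0 /= !coef_derivn addn1 addn0.
rewrite !expr1 !expr0 -[P`_n.+1 *+ _]mulr_natr.
have : (n.+1 ^_ n * 1 = n.+1`!)%N by have := ffact_fact (leqnSn n); rewrite subSnn.
by rewrite muln1 => ->; ring.
Qed.

End PolynomialFacts.

(** * Calculus of piecewise polynomials on [0, 1] *)

Section PiecewiseCalculus01.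
Variable R : realType.
Implicit Types (f g : R -> R) (P : nat -> {poly R}) (x y : R) (K i : nat).

(** The pieces are closed: neighbouring polynomials agree at their common knot, so continuity on
    [0, 1] is built in. *)
Definition piecewise K f P := forall i x, (i < K)%N ->
  knot R K i <= x <= knot R K i.+1 -> f x = (P i).[x].

Lemma knot0 K : knot R K 0 = 0. Proof. by rewrite /knot mul0r. Qed.

Lemma knotK K : (0 < K)%N -> knot R K K = 1.
Proof. by move=> K0; rewrite /knot divff // pnatr_eq0 -lt0n. Qed.

Lemma knot_lt K i : (0 < K)%N -> knot R K i < knot R K i.+1.
Proof. by move=> K0; rewrite /knot ltr_pM2r ?ltr_nat // invr_gt0 ltr0n. Qed.

Lemma knot_le K i j : (i <= j)%N -> knot R K i <= knot R K j.
Proof. by move=> ij; rewrite /knot ler_wpM2r ?ler_nat. Qed.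

Lemma knot_piece K y : (0 < K)%N -> 0 <= y <= 1 ->
  exists2 i, (i < K)%N & knot R K i <= y <= knot R K i.+1.
Proof.
move=> K0; rewrite -(knotK K0) => /andP[y0 y1].
have H n : (0 < n)%N -> y <= knot R K n ->
    exists2 i, (i < n)%N & knot R K i <= y <= knot R K i.+1.
  elim: n => // n IHn _ yn; have [yn'|yn'] := leP (knot R K n) y.
    by exists n => //; rewrite yn' yn.
  case: n => [|n] in IHn yn yn' *; first by move: yn'; rewrite knot0 ltNge y0.
  have [i ik ih] := IHn isT (ltW yn').
  by exists i => //; exact: leqW.
exact: H.
Qed.

Lemma piece01 K i x : (0 < K)%N -> (i < K)%N ->
  knot R K i <= x <= knot R K i.+1 -> 0 <= x <= 1.
Proof.
move=> K0 iK /andP[x0 x1]; apply/andP; split.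
  by apply: le_trans x0; rewrite -(knot0 K) knot_le.
by apply: le_trans x1 _; rewrite -(knotK K0) knot_le.
Qed.

(** Finitely many pieces cover [0, 1], so a local property may be checked on each piece
    separately. *)
Lemma near_pieces (G : set_system R) (S : R -> Prop) K : (0 < K)%N -> Filter G ->
  (forall i, (i < K)%N -> \forall y \near G, knot R K i <= y <= knot R K i.+1 -> S y) ->
  \forall y \near within `[0, 1] G, S y.
Proof.
move=> K0 FG H.
have {}H n : (n <= K)%N -> \forall y \near G, forall i, (i < n)%N ->
    knot R K i <= y <= knot R K i.+1 -> S y.
  elim: n => [_|n IHn nK]; first by near=> y.
  have Hn := H n nK; have {}IHn := IHn (ltnW nK).
  apply: filterS2 Hn IHn => y h1 h2 i; rewrite ltnS leq_eqVlt => /orP[/eqP->//|].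
  exact: h2.
apply: filterS (H K (leqnn K)) => y Hy; rewrite /= in_itv /= => y01.
by have [i iK] := knot_piece K0 y01; exact: Hy.
Unshelve. all: by end_near. Qed.

Lemma near_off_piece K i x : ~~ (knot R K i <= x <= knot R K i.+1) ->
  \forall y \near x, ~~ (knot R K i <= y <= knot R K i.+1).
Proof.
rewrite negb_and -!ltNge => /orP[h|h].
  by near=> y; rewrite negb_and -!ltNge; apply/orP; left; near: y; exact: lt_nbhsl.
by near=> y; rewrite negb_and -!ltNge; apply/orP; right; near: y; exact: lt_nbhsr.
Unshelve. all: by end_near. Qed.

Lemma poly_quot_cvg (P : {poly R}) x :
  ((P.[y] - P.[x]) / (y - x)) @[y --> x^'] --> P^`().[x].
Proof.
have /factor_theorem[T PT] : root (P - (P.[x])%:P) x.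
  by rewrite /root hornerD hornerN hornerC subrr.
have -> : P^`().[x] = T.[x].
  have -> : P^`() = (P - (P.[x])%:P)^`() by rewrite derivB derivC subr0.
  by rewrite PT derivM derivXsubC hornerD !hornerM hornerXsubC subrr mulr0 add0r hornerC mulr1.
have PTy y : P.[y] - P.[x] = T.[y] * (y - x).
  have -> : P.[y] - P.[x] = (P - (P.[x])%:P).[y] by rewrite hornerD hornerN hornerC.
  by rewrite PT hornerM hornerXsubC.
have c : T.[y] @[y --> x^'] --> T.[x].
  by apply: cvg_trans (@continuous_poly R T x); exact/cvg_app/cvg_within.
apply: cvg_trans c; apply: near_eq_cvg; near=> y.
rewrite PTy mulfK // subr_eq0; near: y; exact: nbhs_dnbhs_neq.
Unshelve. all: by end_near. Qed.

(** Pieces not containing x are avoided near x. At a knot, the hypothesis on g makes the one-sided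
    derivatives equal. *)
Lemma piecewise_quot01 K f g P x : (0 < K)%N -> piecewise K f P ->
  piecewise K g (fun i => (P i)^`()) -> 0 <= x <= 1 ->
  quot01 f x y @[y --> within `[0, 1] x^'] --> g x.
Proof.
move=> K0 fP gP x01; apply/cvgrPdist_le => e e0; apply: near_pieces K0 _ _ => i iK.
have [xi|/near_off_piece xi] := boolP (knot R K i <= x <= knot R K i.+1).
  have /cvgrPdist_le /(_ e e0) := @poly_quot_cvg (P i) x.
  apply: filterS => y h yi; rewrite (gP i) // /quot01 (fP i y) // (fP i x) //.
have : \forall y \near x^', ~~ (knot R K i <= y <= knot R K i.+1).
  exact: cvg_within xi.
by apply: filterS => y /negbTE ->.
Qed.

Lemma piecewise_continuous K f P : (0 < K)%N -> piecewise K f P ->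
  {within `[0, 1], continuous f}.
Proof.
move=> K0 fP; apply/subspace_continuousP => x; rewrite /= in_itv /= => x01.
apply/cvgrPdist_le => e e0; apply: near_pieces K0 _ _ => i iK.
have [xi|/near_off_piece xi] := boolP (knot R K i <= x <= knot R K i.+1).
  have /cvgrPdist_le /(_ e e0) := @continuous_poly R (P i) x.
  by apply: filterS => y h yi; move: h; rewrite -(fP i y) // -(fP i x).
by apply: filterS xi => y /negbTE ->.
Qed.

Lemma at_right_within01 x (S : set R) : 0 <= x < 1 ->
  within `[0, 1] x^' S -> x^'+ S.
Proof.
move=> /andP[x0 x1] wS.
have {}wS : \forall y \near x, y != x -> y \in `[0%R, 1%R] -> S y by exact: wS.
have h1 : \forall y \near x, y < 1 by exact: lt_nbhsl.
apply: filterS2 wS h1 => y Sy y1 xy; apply: Sy; first by rewrite gt_eqF.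
by rewrite in_itv /= (ltW y1) andbT (le_trans x0 (ltW xy)).
Qed.

Lemma at_left_within01 x (S : set R) : 0 < x <= 1 ->
  within `[0, 1] x^' S -> x^'- S.
Proof.
move=> /andP[x0 x1] wS.
have {}wS : \forall y \near x, y != x -> y \in `[0%R, 1%R] -> S y by exact: wS.
have h1 : \forall y \near x, 0 < y by exact: lt_nbhsr.
apply: filterS2 wS h1 => y Sy y0 xy; apply: Sy; first by rewrite lt_eqF.
by rewrite in_itv /= (ltW y0) (le_trans (ltW xy)).
Qed.

Lemma piecewise_derivable01 K f g P : (0 < K)%N -> piecewise K f P ->
  piecewise K g (fun i => (P i)^`()) -> derivable01 f.
Proof.
move=> K0 fP gP x; rewrite in_itv /= => x01.
by apply/cvg_ex; exists (g x); exact: piecewise_quot01 fP gP x01.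
Qed.

(* At a knot the limit is taken along the side on which the piece lies. *)
Lemma piecewise_derive01 K f P : (0 < K)%N -> piecewise K f P -> derivable01 f ->
  piecewise K (derive01 f) (fun i => (P i)^`()).
Proof.
move=> K0 fP df i x iK xi; have x01 := piece01 K0 iK xi.
have dfx : quot01 f x y @[y --> within `[0, 1] x^'] --> derive01 f x.
  by apply: df; rewrite in_itv.
have qP : (((P i).[y] - (P i).[x]) / (y - x)) @[y --> x^'] --> (P i)^`().[x].
  exact: poly_quot_cvg.
case/andP: (x01) => x0 x1; case/andP: (xi) => xi0 xi1.
move: xi1; rewrite le_eqVlt => /orP[/eqP xE|xi1].
- have xi0' : knot R K i < x by rewrite xE knot_lt.
  have xl : 0 < x <= 1 by rewrite x1 andbT (le_lt_trans _ xi0') // -(knot0 K) knot_le.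
  have dl : quot01 f x y @[y --> x^'-] --> derive01 f x.
    by apply: cvg_trans dfx => S /= /(at_left_within01 xl).
  have ql : quot01 f x y @[y --> x^'-] --> (P i)^`().[x].
    apply: cvg_trans (cvg_dnbhs_at_left qP); apply: near_eq_cvg; near=> y.
    have yx : y < x by near: y; exact: nbhs_left_lt.
    have iy : knot R K i < y by near: y; exact: nbhs_left_gt.
    by rewrite /quot01 !(fP i) // ?xi // (ltW iy) (ltW (lt_le_trans yx _)) // xE.
  exact: cvg_unique dl ql.
- have xr : 0 <= x < 1 by rewrite x0 (lt_le_trans xi1) // -(knotK K0) knot_le.
  have dl : quot01 f x y @[y --> x^'+] --> derive01 f x.
    by apply: cvg_trans dfx => S /= /(at_right_within01 xr).
  have ql : quot01 f x y @[y --> x^'+] --> (P i)^`().[x].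
    apply: cvg_trans (cvg_dnbhs_at_right qP); apply: near_eq_cvg; near=> y.
    have yx : x < y by near: y; exact: nbhs_right_gt.
    have iy : y < knot R K i.+1 by near: y; exact: nbhs_right_lt.
    by rewrite /quot01 !(fP i) // ?xi // (ltW iy) andbT (le_trans xi0 (ltW yx)).
  exact: cvg_unique dl ql.
Unshelve. all: by end_near. Qed.

(** [C01 n] states continuity of the n-th derivative only; for n > 0, that of f follows from
    differentiability. *)
Lemma C01_left_continuous n f x : C01 n f -> 0 < x <= 1 -> f y @[y --> x^'-] --> f x.
Proof.
case: n => [|n] [df cf] x01; have /andP[x0 x1] := x01.
  move/subspace_continuousP : cf => /(_ x); rewrite /= in_itv /= (ltW x0) x1 => /(_ isT) c.
  apply: cvg_trans c => S /= wS.
  have {}wS : \forall y \near x, y \in `[0%R, 1%R] -> S (f y) by exact: wS.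
  have h1 : \forall y \near x, 0 < y by exact: lt_nbhsr.
  apply: filterS2 wS h1 => y Sy y0 xy; apply: Sy.
  by rewrite in_itv /= (ltW y0) (le_trans (ltW xy)).
have dfx : quot01 f x y @[y --> within `[0, 1] x^'] --> derive01 f x.
  by apply: (df 0%N isT); rewrite in_itv /= (ltW x0).
have dl : quot01 f x y @[y --> x^'-] --> derive01 f x.
  by apply: cvg_trans dfx => S /= /(at_left_within01 x01).
have yx0 : (y - x) @[y --> x^'-] --> x - x.
  by apply: cvgB; [exact/cvg_at_left_filter/cvg_id|exact: cvg_cst].
have c : (f x + quot01 f x y * (y - x)) @[y --> x^'-] --> f x + derive01 f x * (x - x).
  by apply: cvgD; [exact: cvg_cst|exact: cvgM].
rewrite subrr mulr0 addr0 in c; apply: cvg_trans c; apply: near_eq_cvg; near=> y.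
have yx : y < x by near: y; exact: nbhs_left_lt.
by rewrite /quot01 divfK ?subr_eq0 ?lt_eqF // addrC subrK.
Unshelve. all: by end_near. Qed.

(** Splines are given on half-open pieces; left continuity adds the right endpoints, including the
    point 1. *)
Lemma piecewise_closed n K f P : (0 < K)%N -> C01 n f ->
  (forall i x, (i < K)%N -> knot R K i <= x < knot R K i.+1 -> f x = (P i).[x]) ->
  piecewise K f P.
Proof.
move=> K0 cf fP i x iK xi; have x01 := piece01 K0 iK xi.
case/andP: (xi) => xi0; rewrite le_eqVlt => /orP[/eqP xE|xi1]; last by rewrite (fP i) ?xi0.
have xi0' : knot R K i < x by rewrite xE knot_lt.
have xl : 0 < x <= 1.
  by case/andP: x01 => _ ->; rewrite andbT (le_lt_trans _ xi0') // -(knot0 K) knot_le.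
have fl : f y @[y --> x^'-] --> (P i).[x].
  apply: cvg_trans (cvg_at_left_filter (@continuous_poly R (P i) x)).
  apply: near_eq_cvg; near=> y.
  have yx : y < x by near: y; exact: nbhs_left_lt.
  have iy : knot R K i < y by near: y; exact: nbhs_left_gt.
  by rewrite (fP i) // (ltW iy) -xE.
exact: cvg_unique (C01_left_continuous cf xl) fl.
Unshelve. all: by end_near. Qed.

Lemma piecewise_derive01n n K f P : (0 < K)%N -> C01 n f -> piecewise K f P ->
  forall k, (k <= n)%N -> piecewise K (derive01n k f) (fun i => (P i)^`(k)).
Proof.
move=> K0 [df _] fP; elim=> [|k IHk] kn; first by move=> i x iK xi; rewrite derivn0 -fP.
move=> i x iK xi; rewrite derivnS; apply: (piecewise_derive01 K0 (IHk (ltnW kn)) _ iK xi).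
exact: df.
Qed.

Lemma piecewise_C01 n K f P (g : nat -> R -> R) : (0 < K)%N -> piecewise K f P ->
  (forall k, (k <= n)%N -> piecewise K (g k) (fun i => (P i)^`(k))) -> C01 n f.
Proof.
move=> K0 fP gP.
have dP k : (k <= n)%N -> piecewise K (derive01n k f) (fun i => (P i)^`(k)).
  elim: k => [|k IHk] kn; first by move=> i x iK xi; rewrite derivn0 -fP.
  move=> i x iK xi; rewrite derivnS; apply: (piecewise_derive01 K0 (IHk (ltnW kn)) _ iK xi).
  apply: (piecewise_derivable01 K0 (IHk (ltnW kn)) (g := g k.+1)) => i' x' iK' xi'.
  by rewrite -derivnS (gP _ kn i').
split=> [k kn|]; last exact: piecewise_continuous (dP n (leqnn n)).
apply: (piecewise_derivable01 K0 (dP k (ltnW kn)) (g := g k.+1)) => i x iK xi.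
by rewrite -derivnS (gP _ kn i).
Qed.

End PiecewiseCalculus01.

(** * Periodic splines as families of polynomials *)

Section SplinePieces.
Variable R : realType.
Implicit Types (s : R -> R[i]) (P : nat -> {poly R[i]}) (x : R) (p K i j k n : nat).
Local Notation knotC K i := ((knot R K i)%:C : R[i]).

Definition cpiecewise K s P := forall i x, (i < K)%N ->
  knot R K i <= x <= knot R K i.+1 -> s x = (P i).[x%:C].

(* The pieces of a 1-periodic spline of degree p fit together up to order p-1. *)
Definition smooth_periodic p K P : Prop :=
  (forall i k, (i.+1 < K)%N -> (k < p)%N ->
    (P i)^`(k).[knotC K i.+1] = (P i.+1)^`(k).[knotC K i.+1]) /\
  (forall k, (k < p)%N -> (P 0%N)^`(k).[0] = (P K.-1)^`(k).[1]).

Lemma knot_pred_le1 K : (0 < K)%N -> knot R K K.-1 <= 1.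
Proof. by move=> K0; rewrite -(knotK R K0) knot_le ?leq_pred. Qed.

Lemma derivn_sum (I : Type) (r : seq I) (F : I -> {poly R[i]}) k :
  (\sum_(i <- r) F i)^`(k) = \sum_(i <- r) (F i)^`(k).
Proof.
elim: k => [|k IHk] //; rewrite derivnS IHk raddf_sum.
by apply: eq_bigr => i _; rewrite derivnS.
Qed.

Lemma cpiecewise_smooth p K P (D : nat -> R -> R[i]) : (0 < K)%N ->
  (forall k, (k < p)%N -> cpiecewise K (D k) (fun i => (P i)^`(k))) ->
  (forall k, (k < p)%N -> D k 0 = D k 1) -> smooth_periodic p K P.
Proof.
move=> K0 DP D01; split=> [i k iK kp|k kp].
  rewrite -(DP k kp i) ?(ltnW iK) // ?lexx ?ltW ?knot_lt //.
  by rewrite -(DP k kp i.+1) // lexx ltW ?knot_lt.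
have e0 := DP k kp 0%N 0 K0; have e1 := DP k kp K.-1 1.
rewrite -e0 ?D01 ?e1 ?prednK ?knotK ?lexx ?andbT //.
  exact: knot_pred_le1.
by rewrite knot0 lexx -(knot0 R K) ltW ?knot_lt.
Qed.

Lemma smooth_periodic_lin p K P (c : nat -> R[i]) (E : nat -> nat -> {poly R[i]}) :
  smooth_periodic p K P -> (forall j, (0 < j <= K)%N -> smooth_periodic p K (E j)) ->
  smooth_periodic p K (fun i => P i - \sum_(1 <= j < K.+1) c j *: E j i).
Proof.
move=> [P1 P2] E12; split=> [i k iK kp|k kp]; rewrite !derivnB !hornerD !hornerN.
- rewrite P1 //; congr (_ - _); rewrite !derivn_sum !horner_sum; apply: eq_big_nat => j jK.
  by rewrite !derivnZ !hornerZ; have [-> ] := E12 j jK.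
- rewrite P2 //; congr (_ - _); rewrite !derivn_sum !horner_sum; apply: eq_big_nat => j jK.
  by rewrite !derivnZ !hornerZ; have [_ ->] := E12 j jK.
Qed.

(** The derivative of order p-1 is affine on each piece, with slope p! times the coefficient of
    degree p. Its increments telescope to 0 over a period. *)
Lemma smooth_periodic_sum_lead p K P : (0 < p)%N -> (0 < K)%N ->
  (forall i, (i < K)%N -> (size (P i) <= p.+1)%N) -> smooth_periodic p K P ->
  \sum_(0 <= i < K) (P i)`_p = 0.
Proof.
move=> p0 K0 sP [P1 P2]; have pp : (p.-1 < p)%N by rewrite prednK.
(* There is no piece starting at the knot K, so the last piece gives the value at 1. *)
pose h i := if (i < K)%N then (P i)^`(p.-1).[knotC K i] else (P K.-1)^`(p.-1).[1].
have hS i : (i < K)%N -> h i.+1 - h i = p`!%:R * (P i)`_p * (K%:R)^-1.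
  move=> iK; have -> : (K%:R)^-1 = knotC K i.+1 - knotC K i.
    rewrite -rmorphB /= /knot -mulrBl -natr1 addrC addKr mul1r fmorphV.
    by rewrite (rmorph_nat (@real_complex R)).
  rewrite -(prednK p0) -horner_derivn_pred ?prednK ?sP // /h iK; congr (_ - _).
  case: ltnP => [iK'|Ki]; first by rewrite P1.
  have -> : i = K.-1 by apply/eqP; rewrite eqn_leq -ltnS prednK // iK -ltnS prednK.
  by rewrite prednK // knotK.
have : \sum_(0 <= i < K) (h i.+1 - h i) = 0.
  by rewrite telescope_sumr // /h ltnn K0 knot0 P2 // subrr.
rewrite (eq_big_nat _ _ (F2 := fun i => (p`!%:R / K%:R) * (P i)`_p)); last first.
  by move=> i /andP[_ iK]; rewrite hS // mulrAC.
rewrite -big_distrr /= => /eqP; rewrite !mulf_eq0 invr_eq0 !pnatr_eq0.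
by rewrite (gtn_eqF (fact_gt0 p)) (gtn_eqF K0) /= => /eqP.
Qed.

(** Polynomials of degree below p whose derivatives of order below p agree at one point are equal.
    So there is a single polynomial, and periodicity makes it constant. *)
Lemma smooth_periodic_const p K P : (0 < p)%N -> (0 < K)%N ->
  (forall i, (i < K)%N -> (size (P i) <= p)%N) -> smooth_periodic p K P ->
  exists c, forall i, (i < K)%N -> P i = c%:P.
Proof.
move=> p0 K0 sP [P1 P2].
have PS i : (i.+1 < K)%N -> P i = P i.+1.
  move=> iK; apply/eqP; rewrite -subr_eq0; apply/eqP.
  apply: (@poly_eq0_of_derivn _ p _ (knotC K i.+1)) => [|k kp].
    apply: leq_trans (size_polyD _ _) _; rewrite size_polyN geq_max !sP //.
    exact: ltnW.
  by rewrite derivnB hornerD hornerN P1 // subrr.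
have P0 i : (i < K)%N -> P i = P 0%N.
  by elim: i => // i IHi iK; rewrite -PS // IHi // ltnW.
have [c cP] : exists c, P 0%N = c%:P.
  apply: (@polyC_of_derivn_periodic _ p) => [|k kp]; first exact: sP.
  by rewrite P2 // P0 // prednK.
by exists c => i iK; rewrite P0.
Qed.

Lemma derivn_Repoly (T : {poly R[i]}) k : (Repoly T)^`(k) = Repoly T^`(k).
Proof. by elim: k => [|k IHk] //; rewrite !derivnS IHk deriv_Repoly. Qed.

Lemma derivn_Impoly (T : {poly R[i]}) k : (Impoly T)^`(k) = Impoly T^`(k).
Proof. by elim: k => [|k IHk] //; rewrite !derivnS IHk deriv_Impoly. Qed.

Lemma periodic_spline_pieces p K s : (0 < p)%N -> (0 < K)%N -> periodic_spline p K s ->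
  exists P, [/\ forall i, (i < K)%N -> (size (P i) <= p.+1)%N,
    cpiecewise K s P & smooth_periodic p K P].
Proof.
move=> p0 K0 [[[cr ci] sP] per].
have {sP}[P PE] : exists P : nat -> {poly R[i]}, forall i, (i < K)%N ->
    (size (P i) <= p.+1)%N /\ forall x, knot R K i <= x < knot R K i.+1 -> s x = (P i).[x%:C].
  (* Stated for every i, so that the axiom of choice yields a sequence of pieces. *)
  have : forall i, exists T : {poly R[i]}, (i < K)%N -> (size T <= p.+1)%N /\
      forall x, knot R K i <= x < knot R K i.+1 -> s x = T.[x%:C].
    move=> i; have [iK|_] := ltnP i K; last by exists 0.
    by have [T] := sP i iK; exists T.
  by move=> /choice[P PE]; exists P.
have sP i iK := (PE i iK).1.
have rP : piecewise K (fun x => complex.Re (s x)) (fun i => Repoly (P i)).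
  by apply: (piecewise_closed K0 cr) => i x iK xi; rewrite (PE i iK).2 // horner_Repoly.
have iP : piecewise K (fun x => complex.Im (s x)) (fun i => Impoly (P i)).
  by apply: (piecewise_closed K0 ci) => i x iK xi; rewrite (PE i iK).2 // horner_Impoly.
have dP k : (k < p)%N -> cpiecewise K (cderive01n k s) (fun i => (P i)^`(k)).
  move=> kp i x iK xi; have kp' : (k <= p.-1)%N by rewrite -ltnS prednK.
  apply/eqP; rewrite eq_complex /cderive01n /=.
  rewrite (piecewise_derive01n K0 cr rP kp' iK xi) (piecewise_derive01n K0 ci iP kp' iK xi).
  by rewrite derivn_Repoly derivn_Impoly horner_Repoly horner_Impoly !eqxx.
exists P; split=> //.
- move=> i x iK xi; have := dP 0%N p0 i x iK xi; rewrite derivn0 => <-.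
  by apply/eqP; rewrite eq_complex /cderive01n /= !eqxx.
- exact: cpiecewise_smooth dP per.
Qed.

Lemma pieces_periodic_spline p K s P (D : nat -> R -> R[i]) : (0 < p)%N -> (0 < K)%N ->
  (forall i, (i < K)%N -> (size (P i) <= p.+1)%N) ->
  cpiecewise K s P ->
  (forall k, (k < p)%N -> cpiecewise K (D k) (fun i => (P i)^`(k))) ->
  (forall k, (k < p)%N -> D k 0 = D k 1) -> periodic_spline p K s.
Proof.
move=> p0 K0 sP sE DP D01.
have rP : piecewise K (fun x => complex.Re (s x)) (fun i => Repoly (P i)).
  by move=> i x iK xi; rewrite (sE i x iK xi) horner_Repoly.
have iP : piecewise K (fun x => complex.Im (s x)) (fun i => Impoly (P i)).
  by move=> i x iK xi; rewrite (sE i x iK xi) horner_Impoly.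
have rD k : (k <= p.-1)%N ->
    piecewise K (fun x => complex.Re (D k x)) (fun i => (Repoly (P i))^`(k)).
  move=> kp i x iK xi; rewrite (DP k _ i x iK xi) ?derivn_Repoly ?horner_Repoly //.
  by rewrite -(prednK p0) ltnS.
have iD k : (k <= p.-1)%N ->
    piecewise K (fun x => complex.Im (D k x)) (fun i => (Impoly (P i))^`(k)).
  move=> kp i x iK xi; rewrite (DP k _ i x iK xi) ?derivn_Impoly ?horner_Impoly //.
  by rewrite -(prednK p0) ltnS.
have cr := piecewise_C01 K0 rP rD; have ci := piecewise_C01 K0 iP iD.
have [P1 P2] := cpiecewise_smooth K0 DP D01.
split; [split=> // i iK|move=> k kp].
  exists (P i); split; first exact: sP.
  by move=> x /andP[x0 x1]; apply: sE => //; rewrite x0 ltW.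
have kp' : (k <= p.-1)%N by rewrite -ltnS prednK.
have x0 : knot R K 0 <= 0 <= knot R K 1 by rewrite -[X in _ <= X <= _](knot0 R K) lexx ltW ?knot_lt.
have x1 : knot R K K.-1 <= 1 <= knot R K K.-1.+1.
  by rewrite prednK // knotK // lexx andbT knot_pred_le1.
have Kp : (K.-1 < K)%N by rewrite prednK.
apply/eqP; rewrite eq_complex /cderive01n /=.
rewrite (piecewise_derive01n K0 cr rP kp' K0 x0) (piecewise_derive01n K0 ci iP kp' K0 x0).
rewrite (piecewise_derive01n K0 cr rP kp' Kp x1) (piecewise_derive01n K0 ci iP kp' Kp x1).
rewrite !derivn_Repoly !derivn_Impoly !horner_Repoly !horner_Impoly.
by rewrite -[0%:C]/(0 : R[i]) -[1%:C]/(1 : R[i]) P2 // !eqxx.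
Qed.

Lemma poly_eq0_on (T : {poly R[i]}) (a b : R) : a < b ->
  (forall x, a <= x <= b -> T.[x%:C] = 0) -> T = 0.
Proof.
move=> ab T0; apply/eqP; apply/negPn/negP => Tn0.
pose r k : R := a + (b - a) * (k%:R / (size T)%:R).
have s0 : (0 : R) < (size T)%:R by rewrite ltr0n size_poly_gt0.
pose rs := [seq (r k)%:C | k <- iota 0 (size T)].
have := @max_poly_roots _ T rs Tn0; rewrite size_map size_iota ltnn => h.
suff : false by []. apply: h.
- apply/allP => z /mapP[k]; rewrite mem_iota add0n => /andP[_ kT] ->; rewrite rootE; apply/eqP/T0.
  have k0 : (0 : R) <= k%:R by [].
  have q0 : 0 <= k%:R / (size T)%:R :> R by rewrite divr_ge0 // ltW.
  have q1 : k%:R / (size T)%:R <= 1 :> R by rewrite ler_pdivrMr // mul1r ler_nat ltnW.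
  rewrite /r; apply/andP; split; nra.
- rewrite map_inj_uniq ?iota_uniq // => k l [] /addrI.
  have ba : b - a != 0 by rewrite subr_eq0 gt_eqF.
  move=> /(mulfI ba) /(divIf (lt0r_neq0 s0)) /eqP; rewrite eqr_nat => /eqP.
  by [].
Qed.

End SplinePieces.

(** * The basis property *)

Section Basis.
Variable R : realType.
Implicit Types (x : R) (p K n i j k : nat).

(** The right endpoint is included thanks to F_m(1) = z F_m(0), which needs m > 0. *)
Lemma Phi_closed m n K i u x : (0 < m)%N -> (0 < K)%N -> 0 < u <= 1 ->
  knot R K i <= x <= knot R K i.+1 ->
  Phi m (K%:R * x + n%:R) (zexp u) =
  zexp u ^+ (i + n) * (efpoly m (zexp u)).[(K%:R * x - i%:R)%:C].
Proof.
move=> m0 K0 u01 /andP[x0 x1]; have z0 := zexp_neq0 u; have zE := zexp1_or_off u01.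
have K1 : (0 : R) < K%:R by rewrite ltr0n.
have y0 : i%:R <= K%:R * x by move: x0; rewrite /knot ler_pdivrMr // mulrC.
have : K%:R * x <= i.+1%:R by move: x1; rewrite /knot ler_pdivlMr // mulrC.
rewrite le_eqVlt => /orP[/eqP xE|y1].
  have -> : K%:R * x + n%:R = (i + n).+1%:R + 0 by rewrite xE addr0 -addSn natrD.
  rewrite PhiE ?lexx ?ltr01 // xE -natr1 addrAC subrr add0r.
  by rewrite -(prednK m0) horner1_efpoly // mulrA -exprSr.
have -> : K%:R * x + n%:R = (i + n)%:R + (K%:R * x - i%:R) by rewrite natrD; ring.
by rewrite PhiE // subr_ge0 y0 ltrBlDr addrC natr1.
Qed.

Definition bpiece p K n u (al : R[i]) i : {poly R[i]} :=
  (al * zexp u ^+ (i + n)) *: (efpoly p (zexp u) \Po (K%:R *: 'X + (- i%:R)%:P)).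

Definition bder p K n u (al : R[i]) k x : R[i] :=
  al * (K%:R * (1 - (zexp u)^-1)) ^+ k * Phi (p - k) (K%:R * x + n%:R) (zexp u).

Lemma derivn_bpiece p K n u al i k : (k <= p)%N ->
  (bpiece p K n u al i)^`(k) = (al * zexp u ^+ (i + n) * (K%:R * (1 - (zexp u)^-1)) ^+ k) *:
    (efpoly (p - k) (zexp u) \Po (K%:R *: 'X + (- i%:R)%:P)).
Proof. by move=> kp; rewrite /bpiece derivnZ derivn_efpoly_comp // scalerA. Qed.

Lemma bder_piece p K n u al k : (k < p)%N -> (0 < K)%N -> 0 < u <= 1 ->
  cpiecewise K (bder p K n u al k) (fun i => (bpiece p K n u al i)^`(k)).
Proof.
move=> kp K0 u01 i x iK xi; rewrite derivn_bpiece ?(ltnW kp) // hornerZ horner_comp.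
rewrite /bder (Phi_closed _ _ _ u01 xi) ?subn_gt0 //.
have -> : (K%:R *: 'X + (- i%:R)%:P).[x%:C] = (K%:R * x - i%:R)%:C :> R[i].
  rewrite hornerD hornerZ hornerX hornerC rmorphB rmorphM /=.
  by rewrite !(rmorph_nat (@real_complex R)).
by ring.
Qed.

Lemma bder_periodic p K n j al k : (0 < j <= K)%N ->
  bder p K n (j%:R / K%:R) al k 0 = bder p K n (j%:R / K%:R) al k 1.
Proof.
move=> jK; have u01 := ratio01 R jK; have zE := zexp1_or_off u01.
have K0 : (0 < K)%N by case/andP: jK => j0; exact: leq_trans.
rewrite /bder mulr0 mulr1 -natrD add0r -[n%:R]addr0 -[(K + n)%:R]addr0.
by rewrite !PhiE ?lexx ?ltr01 ?zexp_neq0 // exprD zexpX_K // mul1r.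
Qed.

Lemma size_bpiece p K n u al i : (size (bpiece p K n u al i) <= p.+1)%N.
Proof.
apply: leq_trans (size_scale_leq _ _) _; apply: leq_trans (size_comp_poly_leq _ _) _.
rewrite ltnS; apply: (@leq_trans (p * 1)); last by rewrite muln1.
apply: leq_mul; first by rewrite -ltnS; case: (size _) (size_efpoly p (zexp u)).
rewrite -subn1 leq_subLR; apply: leq_trans (size_polyD _ _) _; rewrite geq_max.
apply/andP; split; last by apply: leq_trans (size_polyC_leq1 _) _.
by apply: leq_trans (size_scale_leq _ _) _; rewrite size_polyX.
Qed.

(** The coefficient of degree p of piece 0. For u = 1 and p > 0 it vanishes. *)
Definition bweight p K n u (al : R[i]) : R[i] :=
  al * zexp u ^+ n * (K%:R * (1 - (zexp u)^-1)) ^+ p / p`!%:R.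

Lemma lead_bpiece p K n u al i :
  (bpiece p K n u al i)`_p = bweight p K n u al * zexp u ^+ i.
Proof.
have f0 : p`!%:R != 0 :> R[i] by rewrite pnatr_eq0 -lt0n fact_gt0.
apply: (mulIf f0); have := congr1 (fun T : {poly R[i]} => T`_0) (derivn_bpiece K n u al i (leqnn p)).
rewrite coef_derivn addn0 ffactnn mulr_natr => ->.
rewrite subnn efpoly0 ?zexp_neq0 // -polyC1 comp_polyC coefZ coefC eqxx mulr1.
by rewrite /bweight exprD; field.
Qed.

Lemma bweight_neq0 p K n j al : (0 < j < K)%N -> al != 0 ->
  bweight p K n (j%:R / K%:R) al != 0.
Proof.
move=> /andP[j0 jK] al0; have K0 : (0 < K)%N by exact: leq_trans jK.
have u01 : 0 < (j%:R / K%:R : R) < 1.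
  have K1 : (0 : R) < K%:R by rewrite ltr0n.
  by apply/andP; split; [rewrite divr_gt0 ?K1 // ltr0n|rewrite ltr_pdivrMr // mul1r ltr_nat].
rewrite /bweight !mulf_neq0 ?expf_neq0 ?zexp_neq0 ?invr_eq0 ?pnatr_eq0 -?lt0n ?fact_gt0 //.
rewrite mulf_neq0 ?pnatr_eq0 -?lt0n // subr_eq0 eq_sym invr_eq1 -subr_eq0.
exact: zexp_neq1.
Qed.

Lemma dft_orth K j k : (0 < j <= K)%N -> (0 < k <= K)%N ->
  \sum_(0 <= i < K) zexp (j%:R / K%:R : R) ^+ i * zexp (k%:R / K%:R) ^- i =
  K%:R * (j == k)%:R.
Proof.
move=> jK kK; have K0 : (0 < K)%N by case/andP: jK => j0; exact: leq_trans.
under eq_bigr do rewrite -exprVn -exprMn.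
have [->|jk] := eqVneq j k.
  under eq_bigr do rewrite divff ?zexp_neq0 // expr1n.
  by rewrite sumr_const_nat subn0 mulr1.
rewrite sum_unity ?mulr0 //; first by rewrite exprMn exprVn !zexpX_K // invr1 mulr1.
apply: contra jk => /eqP c1; apply/eqP/(zexp_inj jK kK (R := R)).
by rewrite -[LHS](divfK (zexp_neq0 (k%:R / K%:R))) c1 mul1r.
Qed.

Lemma dft_complete K i l : (i < K)%N -> (l < K)%N ->
  \sum_(1 <= j < K.+1) zexp (j%:R / K%:R : R) ^+ i * zexp (j%:R / K%:R) ^- l =
  K%:R * (i == l)%:R.
Proof.
move=> iK lK; have K0 : (0 < K)%N by exact: leq_trans iK.
have zj j : zexp (j%:R / K%:R : R) = zexp (1%:R / K%:R) ^+ j.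
  by rewrite /zexp expiX; congr expi; ring.
pose w := zexp (1%:R / K%:R : R) ^+ i / zexp (1%:R / K%:R) ^+ l.
have t0 a : zexp (1%:R / K%:R : R) ^+ a != 0 by rewrite expf_neq0 ?zexp_neq0.
have -> : \sum_(1 <= j < K.+1) zexp (j%:R / K%:R : R) ^+ i * zexp (j%:R / K%:R) ^- l =
    w * \sum_(0 <= j < K) w ^+ j.
  rewrite big_distrr big_add1 /=; apply: eq_bigr => j _.
  by rewrite -exprS zj /w expr_div_n -!exprM ![(j.+1 * _)%N]mulnC.
have [il|il] := eqVneq i l.
  have -> : w = 1 by rewrite /w il divff.
  by under eq_bigr do rewrite expr1n; rewrite sumr_const_nat subn0 mulr1 mul1r.
rewrite sum_unity ?mulr0 //.
  by rewrite /w expr_div_n -!exprM ![(_ * K)%N]mulnC !exprM (zexpX_K R 1 K0) !expr1n divr1.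
(* The shift by one moves the indices from 0, ..., K-1 to 1, ..., K, the range of [zexp_inj]. *)
apply: contra il => /eqP w1; apply/eqP/succn_inj.
apply: (@zexp_inj R K); rewrite ?iK ?lK //.
rewrite (zj i.+1) (zj l.+1) !exprS; congr (_ * _).
by rewrite -[LHS](divfK (t0 l)) -/w w1 mul1r.
Qed.

(** Independence: by Fourier inversion of the coefficients of degree p, all c_j with j < K vanish;
    evaluation at 0 then gives c_K = 0. Spanning: the coefficients of degree p are matched by a
    Fourier expansion, and the remainder is a constant, a multiple of e_K. *)
Lemma exponential_spline_basis p K n (al : nat -> R[i]) (e : nat -> R -> R[i]) :
  (0 < p)%N -> (0 < K)%N -> (forall j, (0 < j <= K)%N -> al j != 0) ->
  (forall j x, (0 < j <= K)%N ->
    e j x = al j * Phi p (K%:R * x + n%:R) (zexp (j%:R / K%:R))) ->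
  basis01 (@periodic_spline R p K) K e.
Proof.
move=> p0 K0 al0 eE.
pose E j := bpiece p K n (j%:R / K%:R) (al j).
pose lam j := bweight p K n (j%:R / K%:R) (al j).
have D j k : (0 < j <= K)%N -> (k < p)%N ->
    cpiecewise K (bder p K n (j%:R / K%:R) (al j) k) (fun i => (E j i)^`(k)).
  by move=> jK kp; apply: bder_piece => //; exact: ratio01.
have Ee j : (0 < j <= K)%N -> cpiecewise K (e j) (E j).
  move=> jK i x iK xi; have := D j 0%N jK p0 i x iK xi; rewrite derivn0 => <-.
  by rewrite eE // /bder expr0 mulr1 subn0.
have sE j : (0 < j <= K)%N -> smooth_periodic p K (E j).
  move=> jK; apply: (cpiecewise_smooth K0 (D j ^~ jK)) => k _; exact: bder_periodic.
have KK : (0 < K <= K)%N by rewrite K0 leqnn.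
have eK x : e K x = al K by rewrite eE // divff ?pnatr_eq0 -?lt0n // zexp1 /Phi eqxx mulr1.
have KC0 : K%:R != 0 :> R[i] by rewrite pnatr_eq0 -lt0n.
split.
- move=> j jK; apply: (pieces_periodic_spline p0 K0 _ (Ee j jK) (D j ^~ jK)).
    by move=> i _; exact: size_bpiece.
  by move=> k _; exact: bder_periodic.
- move=> c c0.
  have lead0 i : (i < K)%N -> \sum_(1 <= j < K.+1) c j * (lam j * zexp (j%:R / K%:R) ^+ i) = 0.
    move=> iK; have : \sum_(1 <= j < K.+1) c j *: E j i = 0.
      apply: (poly_eq0_on (knot_lt R i K0)) => x xi; rewrite horner_sum -[RHS](c0 x); last first.
        by rewrite in_itv /=; exact: piece01 xi.
      by apply: eq_big_nat => j jK; rewrite hornerZ (Ee j jK i x).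
    move=> /(congr1 (fun T : {poly R[i]} => T`_p)); rewrite coef0 coef_sum => h.
    by rewrite -[RHS]h; apply: eq_bigr => j _; rewrite coefZ lead_bpiece.
  have cl k : (0 < k <= K)%N -> c k * lam k = 0.
    move=> kK; apply: (mulfI KC0); rewrite mulr0.
    transitivity (\sum_(0 <= i < K)
        (\sum_(1 <= j < K.+1) c j * (lam j * zexp (j%:R / K%:R) ^+ i)) * zexp (k%:R / K%:R) ^- i).
      under eq_bigr do rewrite big_distrl /=.
      rewrite exchange_big_nat /=.
      rewrite (eq_big_nat _ _ (F2 := fun j => c j * lam j * (K%:R * (j == k)%:R))); last first.
        move=> j jK; rewrite -(dft_orth jK kK) big_distrr /=; apply: eq_bigr => i _; ring.
      case/andP: kK => k0 kK.
      rewrite (bigD1_seq k) ?mem_index_iota ?iota_uniq ?k0 //= eqxx mulr1 mulrC big1 ?addr0 //.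
      by move=> j /negbTE ->; rewrite !mulr0.
    by rewrite big_nat big1 // => i iK; rewrite lead0 ?mul0r //; case/andP: iK.
  have clt k : (0 < k < K)%N -> c k = 0.
    move=> kK; case/andP: (kK) => k0 k1.
    have kK' : (0 < k <= K)%N by rewrite k0 ltnW.
    have := cl k kK'; move/eqP; rewrite mulf_eq0 => /orP[/eqP//|].
    by rewrite (negbTE (bweight_neq0 _ _ kK (al0 k kK'))).
  move=> j /andP[j0]; rewrite leq_eqVlt => /orP[/eqP->|jK]; last by rewrite clt ?j0.
  have := c0 0; rewrite in_itv /= lexx ler01 => /(_ isT).
  rewrite big_nat_recr //= big_nat big1 ?add0r; last first.
    by move=> k kK; rewrite clt ?mul0r.
  by rewrite eK => /eqP; rewrite mulf_eq0 (negbTE (al0 K KK)) orbF => /eqP.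
- move=> s /(periodic_spline_pieces p0 K0)[P [sP Ps smP]].
  pose d i := (P i)`_p.
  have d0 : \sum_(0 <= i < K) d i = 0 by exact: smooth_periodic_sum_lead.
  pose a j := K%:R^-1 * \sum_(0 <= l < K) d l * zexp (j%:R / K%:R) ^- l.
  have aK : a K = 0.
    rewrite /a divff ?pnatr_eq0 -?lt0n // zexp1.
    by under eq_bigr do rewrite expr1n invr1 mulr1; rewrite d0 mulr0.
  (* At j = K both terms are 0 and the quotient is 0 by convention. Here a_K = 0 because the
     coefficients of degree p sum to zero. *)
  pose c j := a j / lam j.
  have cl j : (0 < j <= K)%N -> c j * lam j = a j.
    move=> /andP[j0]; rewrite leq_eqVlt => /orP[/eqP->|jK].
      by rewrite /c aK !mul0r.
    by rewrite /c divfK // bweight_neq0 ?j0 // al0 // j0 ltnW.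
  have ad i : (i < K)%N -> \sum_(1 <= j < K.+1) a j * zexp (j%:R / K%:R) ^+ i = d i.
    move=> iK; rewrite /a.
    under eq_bigr do rewrite -mulrA big_distrl /= big_distrr /=.
    rewrite exchange_big_nat /=.
    rewrite (eq_big_nat _ _ (F2 := fun l => d l * (i == l)%:R)); last first.
      move=> l /andP[_ lK]; rewrite -[(i == l)%:R](mulKf KC0) -(dft_complete iK lK).
      rewrite !big_distrr /=; apply: eq_bigr => j _; ring.
    rewrite (bigD1_seq i) ?mem_index_iota ?iota_uniq //= eqxx mulr1 big1 ?addr0 //.
    by move=> l li; rewrite eq_sym (negbTE li) mulr0.
  pose T i := P i - \sum_(1 <= j < K.+1) c j *: E j i.
  have sT i : (i < K)%N -> (size (T i) <= p)%N.
    move=> iK; apply/leq_sizeP => m; rewrite leq_eqVlt => /orP[/eqP<-|pm].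
      rewrite coefB coef_sum -/(d i) -(ad i iK); apply/eqP; rewrite subr_eq0; apply/eqP.
      by apply: eq_big_nat => j jK; rewrite coefZ lead_bpiece mulrA -/(lam j) cl.
    rewrite coefB coef_sum nth_default ?(leq_trans (sP i iK)) // sub0r big1 ?oppr0 // => j _.
    by rewrite coefZ nth_default ?mulr0 // (leq_trans (size_bpiece _ _ _ _ _ _)).
  have [t Tt] := smooth_periodic_const p0 K0 sT (smooth_periodic_lin c smP sE).
  (* The remaining constant t is absorbed by e_K, which is the constant [al K]. *)
  exists (fun j => c j + (j == K)%:R * (t / al K)) => x; rewrite in_itv /= => x01.
  have [i iK xi] := knot_piece K0 x01.
  have := congr1 (fun T : {poly R[i]} => T.[x%:C]) (Tt i iK).
  rewrite hornerD hornerN hornerC -(Ps i x iK xi) horner_sum => /eqP; rewrite subr_eq => /eqP ->.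
  under [RHS]eq_bigr do rewrite mulrDl.
  rewrite big_split /= [LHS]addrC; congr (_ + _).
    by apply: eq_big_nat => j jK; rewrite hornerZ (Ee j jK i x).
  rewrite big_nat_recr //= eqxx mul1r eK divfK ?al0 // big_nat big1 ?add0r // => j /andP[_ jK].
  by rewrite (ltn_eqF jK) !mul0r.
Qed.

End Basis.

(** * The Demmler-Reinsch basis *)

Unset Implicit Arguments.
Set Strict Implicit.

(** For p even the breakpoints of [psi] lie halfway between the knots, so the basis of the spline
    space consists of the translates by half a knot step. Discrete orthogonality for i <> j is
    stated for K dividing N: for p = 1, K = 2, N = 3, i = 1, j = 2, the values of Phi at the design
    points are -1/3, -1/3, 1 against a constant, and the sum is not 0. *)
Theorem lemma1 (R : realType) (p q K N : nat)
    (hp : (0 < p)%N) (hq : (0 < q)%N) (hK : (0 < K)%N) (hN : (0 < N)%N)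
    (hqp : (q <= p)%N) (hKN : (K <= N)%N) :
  (odd p -> basis01 (@periodic_spline R p K) K (psi p K N)) /\
  (~~ odd p -> basis01 (@periodic_spline R p K) K
     (fun j x => psi p K N j (x + (2 * K%:R)^-1))) /\
  (forall i j : nat, (0 < i <= K)%N -> (0 < j <= K)%N ->
     (i = j \/ (K %| N)%N ->
      N%:R^-1 * \sum_(1 <= l < N.+1)
        psi p K N i (l%:R / N%:R : R) * (psi p K N j (l%:R / N%:R))^*
      = (i == j)%:R) /\
     cintegral01 (fun x : R =>
       cderive q (psi p K N i) x * (cderive q (psi p K N j) x)^*)
     = (nu R p q K N i)%:C * (i == j)%:R) /\
  (forall i j : nat, (0 < i <= K)%N -> (0 < j <= K)%N ->
     cintegral01 (fun x : R => phi p K i x * (phi p K j x)^*) = (i == j)%:R /\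
     cintegral01 (fun x : R =>
       cderive q (phi p K i) x * (cderive q (phi p K j) x)^*)
     = (mu R p q K i)%:C * (i == j)%:R).
Proof.
have K1 : (K%:R : R) != 0 by rewrite pnatr_eq0 -lt0n.
have QMj j : (0 < j <= K)%N -> 0 < QM p K N (j%:R / K%:R : R) by exact: QM_gt0.
have Qj j : (0 < j <= K)%N -> 0 < Q (2 * p) (j%:R / K%:R : R).
  by move=> jK; apply/Q_gt0/ratio01.
pose al j : R[i] := (Num.sqrt (QM p K N (j%:R / K%:R : R)))%:C^-1.
have al0 j : (0 < j <= K)%N -> al j != 0.
  by move=> jK; rewrite invr_eq0 fmorph_eq0 gt_eqF // sqrtr_gt0 QMj.
split; [|split; [|split]].
- move=> podd; apply: (@exponential_spline_basis R p K p.+1./2 al _ hp hK al0) => j x jK.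
  have -> : p.+1./2%:R = p.+1%:R / 2 :> R.
    have := congr1 (fun n => n%:R : R) (odd_double_half p.+1).
    by rewrite /= podd add0n -muln2 natrM => <-; rewrite mulfK // pnatr_eq0.
  exact: mulrC.
- move=> peven; apply: (@exponential_spline_basis R p K p.+2./2 al _ hp hK al0) => j x jK.
  have -> : K%:R * x + p.+2./2%:R = K%:R * (x + (2 * K%:R)^-1) + p.+1%:R / 2 :> R.
    have := congr1 (fun n => n%:R : R) (odd_double_half p.+2).
    rewrite /= negbK (negbTE peven) add0n -muln2 natrM -[p.+2]addn1 natrD => e.
    by have -> : p.+1%:R = p./2.+1%:R * 2 - 1 :> R; [rewrite e addrK | field].
  exact: mulrC.
- move=> i j iK jK; split; first exact: discrete_gram.
  exact: (@gram_scaled_Phi R p q K (fun k => QM p K N (k%:R / K%:R)) i j hqp iK jK (QMj i iK)).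
- move=> i j iK jK; split.
    have := @gram0_scaled_Phi R p K (fun k => Q (2 * p) (k%:R / K%:R)) i j iK jK (Qj i iK).
    by rewrite divff ?mul1r // gt_eqF // Qj.
  exact: (@gram_scaled_Phi R p q K (fun k => Q (2 * p) (k%:R / K%:R)) i j hqp iK jK (Qj i iK)).
Qed.
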